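(* There are absolute constants $C_1,C_2>0$ such that the following holds. Let $G$ be a hereditarily monomial group, let $d\ge 1$ be a real number, and let $A\subset G$ be a symmetric normal neighbourhood of the identity such that $|A^n|\le n^d|A|$ for all integers $n\ge 1$. Then there exist a (left and right) translation invariant pseudo-metric $\rho$ on $G$ and a radius $\delta>0$ such that $B:=B(\rho,\delta)$ is a $C_1 d\log^3(2d)$-dimensional ball, $A\subset B$, and $|B|\le \exp(C_2 d\log (2d))|A|$.
   Context: A monomial group is a finite group in which every irreducible complex representation is induced by a one-dimensional representation of some subgroup. A finite group is hereditarily monomial if every subgroup of it is monomial. For $A\subset G$, $A^n$ denotes the $n$-fold product set $\{a_1\cdots a_n: a_i\in A\}$. $A$ is a symmetric neighbourhood of the identity if $1_G\in A$ and $A=A^{-1}$; $A$ is normal if $xA=Ax$ for all $x\in G$. A pseudo-metric $\rho$ on $G$ (nonnegative, $\rho(x,x)=0$, symmetric, triangle inequality, but possibly $\rho(x,y)=0$ for $x\ne y$) is (left and right) translation invariant if $\rho(zx,zy)=\rho(x,y)=\rho(xz,yz)$ for all $x,y,z\in G$. $B(\rho,\delta):=\{x\in G:\rho(x,1_G)\le\delta\}$. A finite ball $B(\rho,\delta)$ with $\delta>0$ is called $D$-dimensional (for real $D$) if $|B(\rho,2\delta')|\le 2^D|B(\rho,\delta')|$ for all $\delta'\in(0,\delta]$. *)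

(* Defs.v *)
From Stdlib Require Import Reals.
From HB Require Import structures.
From mathcomp Require Import all_boot all_order all_algebra all_fingroup all_solvable all_field all_character.
From mathcomp Require Import Rstruct.
Set Implicit Arguments. Unset Strict Implicit. Unset Printing Implicit Defensive.
Import Order.TTheory GRing.Theory Num.Theory.

Local Open Scope group_scope.

Section Defs.
Variable gT : finGroupType.

Definition monomial (G : {group gT}) : Prop :=
  forall i : Iirr G, exists (H : {group gT}) (lam : 'CF(H)),
    [/\ H \subset G, lam \is a linear_char & ('Ind[G] lam = 'chi[G]_i)%R].

Definition hereditarily_monomial (G : {group gT}) : Prop :=
  forall H : {group gT}, H \subset G -> monomial H.

Fixpoint prodset (A : {set gT}) (n : nat) : {set gT} :=
  match n with
  | 0 => [set 1]
  | n'.+1 => A * prodset A n'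
  end.

Definition symmetric_nbhd (A : {set gT}) : Prop := 1 \in A /\ A^-1 = A.

Definition normal_set (G : {group gT}) (A : {set gT}) : Prop :=
  forall x, x \in G -> x *: A = A :* x.

Local Open Scope ring_scope.

Definition pseudo_metric (G : {group gT}) (rho : gT -> gT -> R) : Prop :=
  forall x y z, x \in G -> y \in G -> z \in G ->
    [/\ 0 <= rho x y, rho x x = 0, rho x y = rho y x
      & rho x z <= rho x y + rho y z].

Definition translation_invariant (G : {group gT}) (rho : gT -> gT -> R) : Prop :=
  forall x y z, x \in G -> y \in G -> z \in G ->
    rho (z * x)%g (z * y)%g = rho x y /\ rho (x * z)%g (y * z)%g = rho x y.

Definition ball (G : {group gT}) (rho : gT -> gT -> R) (delta : R) : {set gT} :=
  [set x in G | rho x 1%g <= delta].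

Definition dim_ball (G : {group gT}) (rho : gT -> gT -> R) (delta D : R) : Prop :=
  0 < delta /\
  forall delta', 0 < delta' -> delta' <= delta ->
    (#|ball G rho (2 * delta')|%:R <= Rpower 2 D * #|ball G rho delta'|%:R).

End Defs.

(* Main.v *)
Require Import Defs.
From Stdlib Require Import Reals.
From HB Require Import structures.
From mathcomp Require Import all_boot all_order all_algebra all_fingroup all_solvable all_field all_character.
From mathcomp Require Import Rstruct ring lra zify.
Set Implicit Arguments. Unset Strict Implicit. Unset Printing Implicit Defensive.
Import Order.TTheory GRing.Theory Num.Theory.
Local Open Scope ring_scope.

(** Let [H] be the subgroup generated by [A] and [S = A^m], where [m] is a
    scale, polynomial in [d], at which passing from [A^m] to [A^(m+1)] gains at
    most a factor [65/64].  Convolution by the normal set [S] acts on each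
    irreducible representation of [H] by a scalar, the normalised Fourier
    coefficient.  A nonlinear irreducible character is induced from a proper
    subgroup [K], which contains at most two thirds of [S] since [A] generates
    [H]; hence every large coefficient belongs to a linear character, and from
    there on the argument is abelian.

    Let [P] be the set of linear characters with coefficient close to [1].
    Multiplicativity up to an L2 triangle inequality and Parseval's identity
    give [P] small growth in the dual group, so a greedy covering argument
    produces [T = O(d log d)] characters that control all of [P] up to
    characters of a smaller spectrum [Q] whose fourth powers stay in [P]; the
    latter are absorbed because distances to [1] grow under squaring.  Bohr sets
    of [P] therefore double like [T]-dimensional boxes at every scale, and the
    metric is [max_(u in P) |1 - u (x y^-1)|], rounded up to integers after
    multiplication by a large integer, and large and constant outside [H]. *)

(** * Product sets of a normal symmetric set *)

Section ProductSets.
Variable gT : finGroupType.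
Implicit Types (A S : {set gT}) (G : {group gT}).
Local Open Scope group_scope.

Lemma prodset1 A : prodset A 1 = A.
Proof. by rewrite /= mulg1. Qed.

Lemma prodsetD A i j : prodset A (i + j) = prodset A i * prodset A j.
Proof. by elim: i => [|i IH] /=; rewrite ?mul1g // IH mulgA. Qed.

Lemma prodset_mul A i j : prodset (prodset A i) j = prodset A (i * j).
Proof. by elim: j => [|j IH] /=; rewrite ?muln0 //= IH -prodsetD mulnS. Qed.

Lemma prodset_id A n : 1 \in A -> 1 \in prodset A n.
Proof.
move=> A1; elim: n => [|n IH] /=; first exact: set11.
by rewrite -[1]mulg1 mem_mulg.
Qed.

Lemma prodset_subS A n : 1 \in A -> prodset A n \subset prodset A n.+1.
Proof. by move=> A1; apply/subsetP => x xA; rewrite -[x]mul1g mem_mulg. Qed.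

Lemma prodset_sub A m n : 1 \in A -> (m <= n)%N ->
  prodset A m \subset prodset A n.
Proof.
move=> A1 /subnK <-; elim: (n - m)%N => [|k IH] //.
exact: subset_trans IH (prodset_subS _ A1).
Qed.

Lemma prodset_subgroup G A n : A \subset G -> prodset A n \subset G.
Proof.
move=> AG; elim: n => [|n IH] /=; first by rewrite sub1set group1.
by rewrite mul_subG.
Qed.

Lemma prodset_norm G A n : G \subset 'N(A) -> G \subset 'N(prodset A n).
Proof.
move=> nA; elim: n => [|n IH] /=.
  by apply/normsP => x _; rewrite conjs1g.
by rewrite normsM.
Qed.

Lemma prodset_inv G A n : A \subset G -> G \subset 'N(A) -> A^-1 = A ->
  (prodset A n)^-1 = prodset A n.
Proof.
move=> AG nA AV; elim: n => [|n IH] /=; first by rewrite invg1.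
rewrite invMg IH AV; apply: normC; apply: (subset_trans _ nA).
exact: prodset_subgroup.
Qed.

Lemma normal_set_norm G A : normal_set G A -> G \subset 'N(A).
Proof.
move=> nA; apply/normsP => x xG.
by rewrite conjsgE -nA // -lcosetM mulVg lcoset1.
Qed.
End ProductSets.

(** * Exponential against polynomial growth: a scale of slow growth *)

(** Bernoulli's inequality [(1 + 1/b)^n >= 1 + n/b], cleared of denominators. *)
Lemma bernoulli_expn b n : (b ^ n * (b + n) <= b * b.+1 ^ n)%N.
Proof.
elim: n => [|n IH]; first by rewrite !expn0 addn0 mul1n muln1.
rewrite [(b.+1 ^ _)%N]expnS mulnCA.
apply: leq_trans (leq_mul (leqnn b.+1) IH).
rewrite expnS; nia.
Qed.

(** Bernoulli with [n = b] gives [(1 + 1/b)^b >= 2]; then take [q]-th powers. *)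
Lemma double_expn b q : (0 < b)%N -> (2 ^ q * b ^ (b * q) <= b.+1 ^ (b * q))%N.
Proof.
case: b => [|b] // _.
case: q => [|q]; first by rewrite !muln0 !expn0.
rewrite !expnM -expnMn leq_exp2r //.
have := bernoulli_expn b.+1 b.+1.
by rewrite addnn -mul2n mulnA mulnC leq_pmul2l // mulnC.
Qed.

Lemma sqr_lt_expn d : (0 < d)%N -> ((1024 * d ^ 2).+1 < 2 ^ (16 * d))%N.
Proof.
move=> d0; have -> : (16 * d = d + d + 14 * d)%N by lia.
have d2 : (d <= 2 ^ d)%N by apply: ltnW; apply: ltn_expl.
have := @leq_pexp2l 2 11 (14 * d) isT ltac:(lia).
have -> : (2 ^ 11 = 2 * 1024)%N by rewrite -[1024%N]/(2 ^ 10)%N -expnS.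
have := isT : (2 < 1024)%N.
rewrite !expnD -mulnn; move: 1024%N (2 ^ (14 * d))%N (2 ^ d)%N d2 => K y x dx K2 Ky.
apply: (@leq_ltn_trans (K * (x * x)).+1); first by rewrite ltnS !leq_mul.
apply: (@leq_trans (x * x * (2 * K))); last by rewrite leq_mul.
nia.
Qed.

(* Otherwise the sizes grow by a factor [65/64] for [1024 d^2] steps, which
   beats the polynomial bound. *)
Lemma slow_step (f : nat -> nat) (d : nat) :
    (0 < d)%N -> (0 < f 1)%N ->
    (forall n, (0 < n)%N -> (f n <= n ^ d * f 1)%N) ->
  exists m, [/\ (0 < m)%N, (m <= 1024 * d ^ 2)%N
               & (64 * f m.+1 <= 65 * f m)%N].
Proof.
move=> d0 f1 fpoly; set M := (1024 * d ^ 2)%N.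
have [/existsP[[i iM] /= /andP[i0 Hi]]|/existsPn H] :=
    boolP [exists i : 'I_M.+1, (0 < i)%N && (64 * f i.+1 <= 65 * f i)%N].
  by exists i.
have {H}step i : (0 < i <= M)%N -> (65 * f i <= 64 * f i.+1)%N.
  move=> /andP[i0 iM]; have := H (inord i); rewrite inordK ?ltnS // i0 /=.
  by rewrite -ltnNge => /ltnW.
have grow i : (i <= M)%N -> (65 ^ i * f 1 <= 64 ^ i * f i.+1)%N.
  elim: i => [|i IH] iM; first by rewrite !expn0.
  rewrite !expnS -mulnA (leq_trans (leq_mul (leqnn 65) (IH (ltnW iM)))) //.
  by rewrite mulnCA [(64 * _)%N]mulnC -mulnA leq_mul2l step ?orbT.
have := leq_trans (grow M (leqnn M)) (leq_mul (leqnn _) (fpoly M.+1 isT)).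
rewrite mulnA leq_pmul2r // => bad.
(* Since [M = 64 * 16 d^2], the growth [(65/64)^M] is at least [2^(16 d^2)], while the hypothesis
   allows only [(M + 1)^d], which is smaller. *)
have M64 : M = (64 * (16 * d ^ 2))%N by rewrite /M mulnA.
have := @double_expn 64 (16 * d ^ 2) isT.
rewrite -M64 => /leq_trans/(_ bad).
rewrite mulnC leq_pmul2l ?expn_gt0 // leqNgt => /negP[].
by rewrite -mulnn mulnA expnM ltn_exp2r // /M sqr_lt_expn.
Qed.

(** * Fourier coefficients of a normal set and the random walk it drives *)

Section Spectrum.
Variables (gT : finGroupType) (H : {group gT}) (S : {set gT}).
Hypotheses (SH : S \subset H) (nSH : H \subset 'N(S)%g).
Hypotheses (S1 : 1%g \in S) (SV : S^-1%g = S).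

Definition fhat (i : Iirr H) : algC :=
  (\sum_(s in S) 'chi_i s) / (#|S|%:R * 'chi_i 1%g).

Let oS : #|S|%:R != 0 :> algC.
Proof. by rewrite pnatr_eq0 -lt0n; apply/card_gt0P; exists 1%g. Qed.

Let oH : #|H|%:R != 0 :> algC.
Proof. by rewrite pnatr_eq0 -lt0n cardG_gt0. Qed.

Let SVx x : (x^-1%g \in S) = (x \in S).
Proof. by rewrite -mem_invg SV. Qed.

(** Normality makes the sum of [S] commute with the representation, so Schur's lemma turns it into a
    scalar; taking [y = 1] identifies that scalar. *)
Lemma class_sum_scalar (i : Iirr H) y : y \in H ->
  \sum_(s in S) 'chi_i (s * y)%g = #|S|%:R * fhat i * 'chi_i y.
Proof.
move=> yH; pose rG := 'Chi_i.
pose M := \sum_(s in S) rG s.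
have cM : centgmx rG M.
  apply/centgmxP => x xH; rewrite mulmx_suml mulmx_sumr.
  rewrite [RHS](reindex_inj (conjg_inj x)) /=.
  apply: eq_big => s; first by rewrite memJ_norm // (subsetP nSH).
  move=> sS; have sH := subsetP SH _ sS.
  by rewrite -!repr_mxM ?groupJ // conjgC.
have /is_scalar_mxP[a Ma] := mx_abs_irr_cent_scalar (groupC (socle_irr _)) cM.
have chiE z : z \in H -> 'chi_i z = \tr (rG z).
  by move=> zH; rewrite -irrRepr cfunE zH.
have sum z : z \in H -> \sum_(s in S) 'chi_i (s * z)%g = a * 'chi_i z.
  move=> zH; rewrite (chiE z) // -mxtraceZ -mul_scalar_mx -Ma mulmx_suml.
  rewrite raddf_sum; apply: eq_bigr => s sS; have sH := subsetP SH _ sS.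
  by rewrite chiE ?groupM // repr_mxM.
rewrite sum // /fhat; congr (_ * _).
have := sum _ (group1 H); under eq_bigr do rewrite mulg1.
by move=> ->; field; rewrite oS irr1_neq0.
Qed.

Lemma fhat_real i : fhat i \is Num.real.
Proof.
rewrite rpred_div //; last first.
  by rewrite rpredM ?realn // ger0_real // char1_ge0 // irr_char.
apply/CrealP; rewrite rmorph_sum (reindex_inj invg_inj) /=.
by apply: eq_big => s; rewrite ?SVx // char_inv ?irr_char ?conjCK.
Qed.

Lemma fhat_sqr_ge0 i : 0 <= fhat i ^+ 2.
Proof. by rewrite real_exprn_even_ge0 ?fhat_real. Qed.

Lemma fhat_sqr_le1 i : fhat i ^+ 2 <= 1.
Proof.
rewrite -real_normK ?fhat_real // exprn_ile1 // /fhat normrM normfV.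
have p0 : 0 < #|S|%:R * 'chi_i 1%g :> algC.
  by rewrite mulr_gt0 ?irr1_gt0 // lt0r oS ler0n.
rewrite [`|_ * _|]gtr0_norm // ler_pdivrMr // mul1r.
apply: le_trans (ler_norm_sum _ _ _) _; rewrite -sumr_const mulr_suml.
apply: ler_sum => s _; rewrite mul1r; apply: char1_ge_norm; exact: irr_char.
Qed.

(* The density of the [k]-step random walk with uniform steps in [S], given by
   its Fourier expansion. *)
Definition conv_power (k : nat) : 'CF(H) :=
  \sum_i (fhat i ^+ k * 'chi_i 1%g / #|H|%:R) *: 'chi_i.

Lemma conv_power0 z : z \in H -> conv_power 0 z = (z == 1%g)%:R.
Proof.
move=> zH; apply: (mulfI oH); rewrite mulr_natr -cfRegE cfReg_sum !sum_cfunE.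
rewrite mulr_sumr; apply: eq_bigr => i _; rewrite !cfunE expr0 mul1r.
by rewrite mulrA mulrCA divff // mulr1.
Qed.

(** A step of the walk averages over [S], which multiplies the [i]-th Fourier coefficient by
    [fhat i]. *)
Lemma conv_powerS k z : z \in H ->
  conv_power k.+1 z = (\sum_(s in S) conv_power k (s * z)%g) / #|S|%:R.
Proof.
move=> zH; under eq_bigr do rewrite sum_cfunE.
rewrite sum_cfunE exchange_big mulr_suml; apply: eq_bigr => i _.
under eq_bigr do rewrite cfunE.
rewrite -mulr_sumr class_sum_scalar // !cfunE exprS.
by field; rewrite oS oH.
Qed.

Lemma conv_power_ge0 k z : z \in H -> 0 <= conv_power k z.
Proof.
elim: k z => [|k IH] z zH; first by rewrite conv_power0 // ler0n.
rewrite conv_powerS // divr_ge0 ?ler0n // sumr_ge0 // => s sS.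
by rewrite IH // groupM // (subsetP SH).
Qed.

Lemma conv_power_sum k : \sum_(z in H) conv_power k z = 1.
Proof.
elim: k => [|k IH].
  rewrite (bigD1 1%g) ?group1 //= conv_power0 ?group1 // eqxx big1 ?addr0 //.
  by move=> z /andP[zH /negPf z1]; rewrite conv_power0 // z1.
under eq_bigr => z zH do rewrite conv_powerS //.
rewrite -mulr_suml exchange_big -[RHS](divff oS); congr (_ / _).
rewrite -sumr_const; apply: eq_bigr => s sS; rewrite -IH.
rewrite [RHS](reindex_inj (mulgI s)); apply: eq_bigl => z.
by rewrite groupMl // (subsetP SH).
Qed.

Lemma conv_power_supp k z : z \in H -> conv_power k z != 0 ->
  z \in prodset S k.
Proof.
elim: k z => [|k IH] z zH.
  by rewrite conv_power0 //= inE pnatr_eq0 eqb0 negbK.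
rewrite conv_powerS //; apply: contraR => zS.
rewrite big1 ?mul0r // => s sS; apply/eqP; apply: contraR zS => nz.
have szS := IH (s * z)%g (groupM (subsetP SH _ sS) zH) nz.
by rewrite /= -[z](mulKg s) mem_mulg // SVx.
Qed.

Lemma conv_power_coef k i :
  '[conv_power k, 'chi_i] = fhat i ^+ k * 'chi_i 1%g / #|H|%:R.
Proof.
rewrite cfdot_suml (bigD1 i) //= big1 ?addr0 => [|j ji].
  by rewrite cfdotZl cfdot_irr eqxx mulr1.
by rewrite cfdotZl cfdot_irr (negPf ji) mulr0.
Qed.

(** Both sides equal [|H|^2] times the squared norm of [conv_power k]. *)
Lemma parseval k :
  \sum_i fhat i ^+ (k * 2) * 'chi_i 1%g ^+ 2
    = #|H|%:R * \sum_(z in H) conv_power k z ^+ 2.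
Proof.
have <- : #|H|%:R ^+ 2 * '[conv_power k] = #|H|%:R * \sum_(z in H) conv_power k z ^+ 2.
  rewrite cfdotE mulrA expr2 mulfK //; congr (_ * _).
  apply: eq_bigr => z zH; rewrite expr2; congr (_ * _); apply/CrealP.
  exact: ger0_real (conv_power_ge0 _ zH).
rewrite cfdot_sum_irr mulr_sumr; apply: eq_bigr => i _.
rewrite !conv_power_coef (CrealP _); first by rewrite exprM; field.
rewrite rpred_div ?realn // rpredM ?rpredX ?fhat_real //.
by rewrite ger0_real // char1_ge0 // irr_char.
Qed.

(** After one step the walk is uniform on [S], so its squares sum to [1/|S|]. *)
Lemma parseval1 : \sum_i fhat i ^+ 2 * 'chi_i 1%g ^+ 2 = #|H|%:R / #|S|%:R.
Proof.
rewrite (parseval 1); congr (_ * _).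
transitivity (\sum_(z in H) (z \in S)%:R / #|S|%:R ^+ 2 : algC).
  apply: eq_bigr => z zH; rewrite conv_powerS //.
  suff -> : \sum_(s in S) conv_power 0 (s * z)%g = (z \in S)%:R.
    by rewrite expr_div_n; case: (z \in S); rewrite ?expr1n ?expr0n.
  transitivity (\sum_(s in S) (s * z == 1)%g%:R : algC).
    by apply: eq_bigr => s sS; rewrite conv_power0 // groupM // (subsetP SH).
  have [zS|zS] := boolP (z \in S).
    rewrite (bigD1 z^-1%g) /=; last by rewrite SVx.
    rewrite mulVg eqxx big1 ?addr0 // => s /andP[_ sz].
    by rewrite mulg_eq1 (negPf sz).
  rewrite big1 // => s sS; case: eqP => // /eqP.
  by rewrite -eq_invg_mul => /eqP sz; rewrite -sz SVx sS in zS.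
rewrite -mulr_suml -natr_sum.
have -> : (\sum_(z in H) (z \in S) = #|S|)%N.
  rewrite -big_mkcondr sum1_card; apply: eq_card => z.
  by rewrite unfold_in; apply: andb_idl; apply: (subsetP SH).
by field.
Qed.

(** Cauchy-Schwarz: a probability density supported on [P = S^k] has squares summing to at least
    [1/|P|], seen here from the nonnegative squares of its deviations from [1/|P|]. *)
Lemma parseval_ge k : #|H|%:R / #|prodset S k|%:R <=
  \sum_i fhat i ^+ (k * 2) * 'chi_i 1%g ^+ 2.
Proof.
rewrite parseval ler_wpM2l ?ler0n //; set P := prodset S k.
have PH : P \subset H by apply: prodset_subgroup.
have oP : 0 < #|P|%:R :> algC.
  by rewrite ltr0n; apply/card_gt0P; exists 1%g; apply: prodset_id.
have restr (F : algC -> algC) : F 0 = 0 ->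
    \sum_(z in H) F (conv_power k z) = \sum_(z in P) F (conv_power k z).
  move=> F0; rewrite (big_setID P) /= (setIidPr PH) [X in _ + X]big1 ?addr0 //.
  move=> z /setDP[zH zP]; rewrite (_ : conv_power k z = 0) //; apply/eqP.
  by apply: contraR zP; apply: conv_power_supp.
rewrite (restr (fun a => a ^+ 2)) ?expr0n //.
have s1 : \sum_(z in P) conv_power k z = 1 by rewrite -(restr id) ?conv_power_sum.
have : 0 <= \sum_(z in P) (conv_power k z - #|P|%:R^-1) ^+ 2.
  apply: sumr_ge0 => z zP; rewrite real_exprn_even_ge0 // rpredB //.
    exact: ger0_real (conv_power_ge0 _ (subsetP PH _ zP)).
  by rewrite rpredV realn.
under eq_bigr do rewrite sqrrB.
rewrite big_split sumrB /= sumrMnl -mulr_suml s1 sumr_const.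
rewrite mul1r -[X in _ + X]mulr_natr.
have -> : #|P|%:R^-1 ^+ 2 * #|P|%:R = #|P|%:R^-1 :> algC by field; rewrite gt_eqF.
by rewrite mulr2n opprD addrA subrK subr_ge0.
Qed.
End Spectrum.

(** * Spread of linear characters and the size of the large spectrum *)

Section LargeSpectrum.
Variables (gT : finGroupType) (H : {group gT}) (S : {set gT}).
Hypotheses (SH : S \subset H) (nSH : H \subset 'N(S)%g).
Hypotheses (S1 : 1%g \in S) (SV : S^-1%g = S).

(* The walk takes two steps so that [spread] sees only the square of the Fourier
   coefficient: a coefficient near [-1] is then as good as one near [1]. *)
Definition spread (phi : 'CF(H)) : algC :=
  \sum_(z in H) conv_power H S 2 z * `|1 - phi z| ^+ 2.

(** Expand [|1 - chi|^2 = 2 - chi - conj chi]; the two-step density integrates [chi] and its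
    conjugate to [fhat^2]. *)
Lemma spreadE i : 'chi_i \is a linear_char ->
  spread 'chi_i = 2 - 2 * fhat S i ^+ 2.
Proof.
move=> lini; have oH : #|H|%:R != 0 :> algC by rewrite pnatr_eq0 -lt0n cardG_gt0.
have coef : \sum_(z in H) conv_power H S 2 z * ('chi_i z)^* = fhat S i ^+ 2.
  have := conv_power_coef S 2 i; rewrite cfdotE lin_char1 // mulr1.
  by rewrite [LHS]mulrC => /(mulIf _) -> //; rewrite invr_eq0.
have coefC : \sum_(z in H) conv_power H S 2 z * 'chi_i z = fhat S i ^+ 2.
  have real : (fhat S i ^+ 2)^* = fhat S i ^+ 2.
    by apply/CrealP; rewrite rpredX // fhat_real.
  rewrite -real -coef rmorph_sum; apply: eq_bigr => z zH.
  rewrite rmorphM /= conjCK; congr (_ * _); symmetry; apply/CrealP.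
  by rewrite ger0_real // conv_power_ge0.
transitivity (\sum_(z in H) (conv_power H S 2 z * 2 -
   (conv_power H S 2 z * 'chi_i z + conv_power H S 2 z * ('chi_i z)^* ))).
  apply: eq_bigr => z zH; rewrite -mulrDr -mulrBr; congr (_ * _).
  have n1 := normC_lin_char lini zH.
  rewrite normCK rmorphB rmorph1 mulrBl !mulrBr !mul1r !mulr1 -normCK n1 expr1n.
  by ring.
by rewrite sumrB big_split /= coef coefC -mulr_suml conv_power_sum //; ring.
Qed.

(* Minkowski in L2, with the weighted AM-GM inequality in place of square roots. *)
Lemma spreadM (phi psi : 'CF(H)) (r : nat) (t : algC) : (0 < r)%N ->
    phi \is a linear_char -> psi \is a linear_char ->
    spread phi <= r%:R ^+ 2 * t -> spread psi <= t ->
  spread (phi * psi) <= r.+1%:R ^+ 2 * t.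
Proof.
move=> r0 linphi linpsi sphi spsi.
have r0' : 0 < r%:R :> algC by rewrite ltr0n.
(* The weights [1 + 1/r] and [1 + r] are those for which the bounds [r^2 t] and [t] add up to
   exactly [(r + 1)^2 t]. *)
have pt : spread (phi * psi) <= (1 + r%:R^-1) * spread phi + (1 + r%:R) * spread psi.
  rewrite /spread !mulr_sumr -big_split /=; apply: ler_sum => z zH.
  rewrite !(mulrCA _ (conv_power H S 2 z)) -mulrDr ler_wpM2l ?conv_power_ge0 //.
  have tri : `|1 - (phi * psi) z| <= `|1 - phi z| + `|1 - psi z|.
    rewrite cfunE (_ : _ - _ = (1 - phi z) + phi z * (1 - psi z)); last by ring.
    by rewrite (le_trans (ler_normD _ _)) // normrM (normC_lin_char linphi) // mul1r.
  have rl := normr_real (1 - phi z); have rs := normr_real (1 - psi z).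
  apply: (@le_trans _ _ ((`|1 - phi z| + `|1 - psi z|) ^+ 2)).
    by rewrite ler_pXn2r // nnegrE ?addr_ge0.
  move: (`|1 - phi z|) (`|1 - psi z|) rl rs => p q rl rs; rewrite -subr_ge0.
  rewrite (_ : _ - _ = (r%:R * q - p) ^+ 2 / r%:R); last by field; rewrite gt_eqF.
  rewrite divr_ge0 ?ler0n // real_exprn_even_ge0 //.
  by rewrite rpredB // rpredM // realn.
apply: le_trans pt _; rewrite (_ : r.+1%:R ^+ 2 * t =
   (1 + r%:R^-1) * (r%:R ^+ 2 * t) + (1 + r%:R) * t); last first.
  by rewrite -natr1; field; rewrite gt_eqF.
rewrite lerD // ler_wpM2l // addr_ge0 ?ler01 ?invr_ge0 ?ler0n //.
Qed.

(** Every element of [P] contributes at least 1/2 to the one-step Parseval sum, whose total is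
    [|H|/|S|]. *)
Lemma large_spectrum_le (P : {set Iirr H}) :
    (forall i, i \in P -> 2^-1 <= fhat S i ^+ 2) -> (#|P| * #|S| <= 2 * #|H|)%N.
Proof.
move=> HP; have S0 : 0 < #|S|%:R :> algC by rewrite ltr0n; apply/card_gt0P; exists 1%g.
have irr1_ge1 (i : Iirr H) : 1 <= 'chi_i 1%g.
  have := irr1_gt0 i; have /natrP[n ->] := Cnat_irr1 i.
  by rewrite ltr0n ler1n.
have : #|P|%:R / 2 <= #|H|%:R / #|S|%:R :> algC.
  rewrite -(parseval1 SH nSH S1 SV) -sumr_const mulr_suml.
  rewrite [leRHS](bigID (mem P)) /= -[leLHS]addr0 lerD //.
    apply: ler_sum => i iP; rewrite mul1r (le_trans (HP i iP)) //.
    by rewrite ler_peMr ?fhat_sqr_ge0 // exprn_ege1.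
  apply: sumr_ge0 => i _; rewrite mulr_ge0 ?fhat_sqr_ge0 // exprn_ge0 //.
  exact: le_trans ler01 (irr1_ge1 i).
rewrite ler_pdivrMr ?ltr0n // mulrAC ler_pdivlMr // -!natrM ler_nat.
by rewrite [(2 * _)%N]mulnC.
Qed.

(** Compares Parseval for [b q + 1] steps with Parseval for one step. Outside the spectrum the [b q]
    extra steps gain a factor [2^-q], so the tail is at most half of the lower bound [|H|/|S^k|];
    each linear character inside contributes at most 1. *)
Lemma large_spectrum_ge (b q : nat) :
    (0 < b)%N ->
    (forall i : Iirr H, 'chi_i \isn't a linear_char -> fhat S i ^+ 2 <= 2^-1) ->
    (2 * #|prodset S (b * q).+1| <= 2 ^ q * #|S|)%N ->
  (#|H| <= 2 * #|prodset S (b * q).+1| *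
      #|[set i : Iirr H | ('chi_i \is a linear_char)
                          && (b%:R / b.+1%:R <= fhat S i ^+ 2)%R]|)%N.
Proof.
move=> b0 nonlin; set k := (b * q).+1; set P := [set i | _]; set N := #|prodset S k|.
move=> small; set c : algC := b%:R / b.+1%:R.
have c0 : 0 <= c by rewrite divr_ge0 ?ler0n.
have S0 : 0 < #|S|%:R :> algC by rewrite ltr0n; apply/card_gt0P; exists 1%g.
have N0 : 0 < N%:R :> algC.
  by rewrite ltr0n; apply/card_gt0P; exists 1%g; apply: prodset_id.
have := S0; have := N0; rewrite !ltr0n => N0n S0n.
have c2 : 2^-1 <= c.
  rewrite ler_pdivlMr ?ltr0n // mulrC ler_pdivrMr ?ltr0n // -natrM ler_nat; lia.
have cq : c ^+ (b * q) <= (2 ^+ q)^-1.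
  rewrite expr_div_n ler_pdivrMr ?exprn_gt0 ?ltr0n // mulrC.
  rewrite ler_pdivlMr ?exprn_gt0 ?ltr0n // -!natrX -natrM ler_nat mulnC.
  exact: double_expn.
have outP i : i \notin P -> fhat S i ^+ 2 <= c.
  rewrite inE negb_and => /orP[/nonlin/le_trans->//|].
  rewrite -real_ltNge ?ger0_real ?fhat_sqr_ge0 //; exact: ltW.
have chi0 (i : Iirr H) : 0 <= 'chi_i 1%g ^+ 2.
  by rewrite exprn_ge0 // char1_ge0 ?irr_char.
have : #|H|%:R / N%:R <= #|P|%:R + (2 ^+ q)^-1 * (#|H|%:R / #|S|%:R) :> algC.
  apply: le_trans (parseval_ge SH nSH S1 SV k) _; rewrite -(parseval1 SH nSH S1 SV).
  rewrite (bigID (mem P)) /= -sumr_const mulr_sumr.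
  rewrite [X in _ <= _ + X](bigID (mem P)) /= addrA; apply: lerD.
    rewrite -[leLHS]addr0 lerD //.
      apply: ler_sum => i; rewrite inE => /andP[/lin_char1-> _].
      by rewrite expr1n mulr1 mulnC exprM exprn_ile1 ?fhat_sqr_ge0 ?fhat_sqr_le1.
    apply: sumr_ge0 => i _; rewrite mulr_ge0 ?invr_ge0 ?exprn_ge0 ?ler0n //.
    by rewrite mulr_ge0 ?fhat_sqr_ge0.
  apply: ler_sum => i iP; rewrite [leRHS]mulrA ler_wpM2r // mulnC exprM /k.
  move: (fhat_sqr_ge0 SV i) (outP i iP) => f0 fc.
  rewrite [_ ^+ (b * q).+1]exprSr ler_wpM2r //; apply: le_trans cq.
  by rewrite lerXn2r ?nnegrE.
have half : (2 ^+ q)^-1 * (#|H|%:R / #|S|%:R) <= #|H|%:R / N%:R / 2 :> algC.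
  rewrite mulrCA -!mulrA ler_wpM2l ?ler0n // -!invfM.
  rewrite lef_pV2 ?posrE ?mulr_gt0 ?exprn_gt0 ?ltr0n ?S0n ?N0n //.
  by rewrite -natrX -!natrM ler_nat mulnC.
move=> /le_trans/(_ (lerD (lexx _) half)).
rewrite -lerBlDr (_ : _ - _ = #|H|%:R / (2 * N%:R)); last by field; rewrite gt_eqF.
by rewrite ler_pdivrMr ?mulr_gt0 ?ltr0n // -!natrM ler_nat mulnC.
Qed.
End LargeSpectrum.

(** * Consequences of slow growth at scale [m] *)

Section SlowGrowth.
Variables (gT : finGroupType) (H : {group gT}) (A : {set gT}) (m : nat).
Hypotheses (AH : <<A>>%g = H) (nAH : H \subset 'N(A)%g) (A1 : 1%g \in A).
Hypothesis AV : A^-1%g = A.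
Hypothesis slow : (64 * #|prodset A m.+1| <= 65 * #|prodset A m|)%N.

Let S := prodset A m.

Let S1 : 1%g \in S.
Proof. exact: prodset_id. Qed.

Let S0 : 0 < #|S|%:R :> algC.
Proof. by rewrite ltr0n; apply/card_gt0P; exists 1%g. Qed.

Let subAH : A \subset H.
Proof. by rewrite -AH subset_gen. Qed.

(* If [a] lies in [A] but not in [K], then [a (S :&: K)] and [S :&: K] are
   disjoint subsets of [A ^ (m + 1)]. *)
Lemma slow_proper_subgroup (K : {group gT}) : K \subset H -> ~~ (H \subset K) ->
  (3 * #|S :&: K| <= 2 * #|S|)%N.
Proof.
rewrite -{2}AH gen_subG => KH /subsetPn[a aA aK].
have sub : (S :&: K) :|: (a *: (S :&: K))%g \subset prodset A m.+1.
  rewrite subUset (subset_trans (subsetIl _ _) (prodset_subS _ A1)) /=.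
  by apply/subsetP => _ /lcosetP[x /setIP[xS _] ->]; apply: mem_mulg.
have dis : [disjoint S :&: K & (a *: (S :&: K))%g].
  rewrite -setI_eq0; apply/eqP/setP => x; rewrite !inE; apply/negP.
  case/andP => /andP[_ xK] /lcosetP[y /setIP[_ yK] xay].
  by rewrite xay groupMr // (negPf aK) in xK.
have := subset_leq_card sub; rewrite cardsU (disjoint_setI0 dis) cards0 subn0.
rewrite card_lcoset => c2; move: slow c2; rewrite -/S.
by move: #|S| #|S :&: K| #|_|; clear; lia.
Qed.

(** Averaging the induction formula over the normal set [S] reduces [fhat] to the mean over [S] of
    [lam], which vanishes off the proper subgroup [K]. So its norm is at most 2/3, and 4/9 is below
    1/2. *)
Lemma nonlinear_fhat : monomial H ->
  forall i : Iirr H, 'chi_i \isn't a linear_char -> fhat S i ^+ 2 <= 2^-1.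
Proof.
move=> monH i nonlin; have [K [lam [KH linlam Dchi]]] := monH i.
have prK : ~~ (H \subset K).
  apply: contra nonlin => HK; have eKH : K = H.
    by apply/val_inj/eqP; rewrite eqEsubset /= KH.
  by subst K; rewrite -Dchi cfInd_id.
have nSH : H \subset 'N(S)%g by apply: prodset_norm.
have oK : #|K|%:R != 0 :> algC by rewrite pnatr_eq0 -lt0n cardG_gt0.
have oH : 0 < #|H|%:R :> algC by rewrite ltr0n cardG_gt0.
have chi1 : 'chi_i 1%g = #|H|%:R / #|K|%:R.
  by rewrite -Dchi cfInd1 // lin_char1 // mulr1 -(Lagrange KH) natrM mulrC mulKf.
have sumchi : \sum_(s in S) 'chi_i s = 'chi_i 1%g * \sum_(s in S) lam s.
  transitivity (\sum_(s in S) #|K|%:R^-1 * \sum_(y in H) lam (s ^ y)%g).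
    by apply: eq_bigr => s _; rewrite -Dchi cfIndE.
  rewrite -mulr_sumr exchange_big /= chi1 [RHS]mulrAC [RHS]mulrC; congr (_ * _).
  rewrite -sumr_const mulr_suml; apply: eq_bigr => y yH; rewrite mul1r.
  rewrite [RHS](reindex_inj (conjg_inj y)) /=; apply: eq_bigl => s.
  by rewrite memJ_norm // (subsetP nSH).
have Dfhat : fhat S i = (\sum_(s in S) lam s) / #|S|%:R.
  by rewrite /fhat sumchi; field; rewrite irr1_neq0 gt_eqF.
have nf : `|fhat S i| <= 2 / 3.
  rewrite Dfhat normrM normfV normr_nat ler_pdivrMr //.
  apply: (@le_trans _ _ #|S :&: K|%:R).
    apply: le_trans (ler_norm_sum _ _ _) _; rewrite (big_setID K) /=.
    rewrite [X in _ + X]big1 ?addr0 => [|s /setDP[_ sK]]; last by rewrite cfun0 ?normr0.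
    rewrite -sumr_const ler_sum // => s /setIP[_ sK].
    by rewrite (normC_lin_char linlam sK).
  rewrite mulrAC ler_pdivlMr ?ltr0n // -!natrM ler_nat mulnC.
  exact: slow_proper_subgroup.
have fr : fhat S i \is Num.real.
  by apply: fhat_real; apply: (prodset_inv _ subAH nAH AV).
rewrite -real_normK // (le_trans (lerXn2r _ _ _ nf)) ?nnegrE ?divr_ge0 ?ler0n //.
rewrite expr_div_n ler_pdivrMr ?exprn_gt0 ?ltr0n // mulrC ler_pdivlMr ?ltr0n //.
by rewrite -!natrX -!natrM ler_nat.
Qed.

(** Multiplying the sum of [u] over [S] by [1 - u a] leaves only [S] minus [a S] and [a S] minus
    [S], each of size at most [|S|/64]. Dividing by a sum of norm at least [|S|/2] yields 1/16. *)
Lemma slow_close (u : 'CF(H)) a : u \is a linear_char -> a \in A ->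
  2^-1 <= `|(\sum_(s in S) u s) / #|S|%:R| -> `|1 - u a| <= 16%:R^-1.
Proof.
move=> linu aA half.
have aH := subsetP subAH _ aA.
have SH : S \subset H by apply: prodset_subgroup.
have cd : (64 * #|(a *: S)%g :\: S| <= #|S|)%N.
  have sub : (a *: S)%g :|: S \subset prodset A m.+1.
    rewrite subUset (prodset_subS _ A1) andbT.
    by apply/subsetP => _ /lcosetP[x xS ->]; apply: mem_mulg.
  have := subset_leq_card sub; rewrite -(cardsID S (_ :|: _)).
  rewrite setIUl setIid setDUl setDv setU0 (setUidPr (subsetIr _ _)) => c2.
  by move: slow c2; rewrite -/S; move: #|S| #|_ :\: _| #|prodset _ _|; clear; lia.
have cd' : #|S :\: (a *: S)%g| = #|(a *: S)%g :\: S|.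
  apply: (@addnI #|(a *: S)%g :&: S|).
  by rewrite cardsID card_lcoset setIC cardsID.
have sumS (P : {set gT}) : P \subset H -> `|\sum_(s in P) u s| <= #|P|%:R.
  move=> PH; apply: le_trans (ler_norm_sum _ _ _) _.
  rewrite -sumr_const ler_sum // => s sP.
  by rewrite (normC_lin_char linu) // (subsetP PH).
have diff : (\sum_(s in S) u s) * (1 - u a) =
    \sum_(s in S :\: (a *: S)%g) u s - \sum_(s in (a *: S)%g :\: S) u s.
  have -> : (\sum_(s in S) u s) * (1 - u a) =
      \sum_(s in S) u s - \sum_(s in (a *: S)%g) u s.
    rewrite mulrBr mulr1; congr (_ - _); rewrite mulr_suml.
    rewrite [RHS](reindex_inj (mulgI a)) /=.
    apply: eq_big => s; first by rewrite mem_lcoset mulKg.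
    by move=> sS; have sH := subsetP SH _ sS; rewrite lin_charM // mulrC.
  rewrite (big_setID (a *: S)%g) [X in _ - X](big_setID S) /= setIC.
  by rewrite opprD addrACA subrr add0r.
have aSH : (a *: S)%g \subset H.
  by apply/subsetP => _ /lcosetP[x xS ->]; rewrite groupM // (subsetP SH).
have bound : `|\sum_(s in S) u s| * `|1 - u a| <= #|S|%:R / 32%:R.
  rewrite -normrM diff (le_trans (ler_normB _ _)) //.
  have s1 := sumS _ (subset_trans (subsetDl S (a *: S)%g) SH).
  have s2 := sumS _ (subset_trans (subsetDl (a *: S)%g S) aSH).
  rewrite (le_trans (lerD s1 s2)) // cd' ler_pdivlMr ?ltr0n // -natrD -natrM.
  by rewrite ler_nat; move: cd; move: #|S| #|_ :\: _|; clear; lia.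
have : #|S|%:R / 2 * `|1 - u a| <= #|S|%:R / 32%:R.
  apply: le_trans bound; rewrite ler_wpM2r //.
  move: half; rewrite normrM normfV normr_nat ler_pdivlMr //.
  by rewrite mulrC.
rewrite -mulrA ler_pM2l // mulrC ler_pdivrMr ?ltr0n // => /le_trans; apply.
rewrite mulrC ler_pdivrMr ?ltr0n // mulrC ler_pdivlMr ?ltr0n //.
by rewrite -natrM ler_nat.
Qed.
End SlowGrowth.

(** * Spread of linear characters under conjugation *)

Section LinearSpread.
Variables (gT : finGroupType) (H : {group gT}) (S : {set gT}).
Hypotheses (SH : S \subset H) (nSH : H \subset 'N(S)%g).
Hypotheses (S1 : 1%g \in S) (SV : S^-1%g = S).

Lemma spread_lin (u : 'CF(H)) : u \is a linear_char ->
  spread S u = 2 - 2 * ((\sum_(s in S) u s) / #|S|%:R) ^+ 2.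
Proof.
move=> linu; have /irrP[i Du] := lin_char_irr linu.
by rewrite Du spreadE // -?Du // /fhat -Du lin_char1 // mulr1.
Qed.

Lemma spread_conj (u : 'CF(H)) y : u \is a linear_char ->
  y \in 'N(S)%g -> y \in 'N(H)%g -> spread S (u ^ y)%CF = spread S u.
Proof.
move=> linu yS yH; rewrite !spread_lin ?cfConjg_lin_char //.
congr (_ - _ * (_ / _) ^+ _).
rewrite [RHS](reindex_inj (conjg_inj y^-1%g)) /=.
apply: eq_big => s; first by rewrite memJ_norm ?groupV.
by move=> _; rewrite cfConjgE.
Qed.
End LinearSpread.

(** * Greedy covering in a finite group *)

Section GreedyCover.
Variable L : finGroupType.
Implicit Types (P Q : {set L}) (Lam : seq L).
Local Open Scope group_scope.

(** [Q] times the products of subfamilies of [Lam]; its size doubles at each entry whose translate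
    is disjoint from the previous cube. *)
Fixpoint cube Q Lam : {set L} :=
  if Lam is l :: Lam' then cube Q Lam' :|: cube Q Lam' :* l else Q.

Lemma cube_ind Q Lam (f : L -> algC) (c : algC) :
    (forall u v, f (u * v)%g <= f u + f v)%R -> (forall u, 0 <= f u)%R ->
    {in Q, forall q, f q <= c}%R ->
  {in cube Q Lam, forall y, f y <= c + (\sum_(l <- Lam) f l)}%R.
Proof.
move=> fM f0 fQ; elim: Lam => [|l Lam IH] y /=.
  by rewrite big_nil addr0; apply: fQ.
rewrite big_cons inE => /orP[/IH fy|/rcosetP[x /IH fx ->]].
  by rewrite (le_trans fy) // lerD2l lerDr.
by rewrite (le_trans (fM _ _)) // addrCA addrC lerD.
Qed.

(** Keep adding to [Lam] an [l] in [P] whose translate misses the current cube. Each addition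
    doubles the cube, so the size hypothesis stops this before [T] additions; by then every
    translate meets the cube. *)
Lemma greedy_cover P Q (T : nat) :
    (forall Lam, size Lam = T -> {subset Lam <= P} ->
       #|cube Q Lam| < 2 ^ T * #|Q|)%N ->
  exists Lam, [/\ (size Lam <= T)%N, {subset Lam <= P} &
    forall l, l \in P -> exists2 y, y \in cube Q Lam & y * l \in cube Q Lam].
Proof.
move=> small.
suff grow t : (t <= T)%N ->
   (exists Lam, [/\ (size Lam <= T)%N, {subset Lam <= P} &
      forall l, l \in P -> exists2 y, y \in cube Q Lam & y * l \in cube Q Lam]) \/
   (exists Lam, [/\ size Lam = t, {subset Lam <= P} &
      #|cube Q Lam| = (2 ^ t * #|Q|)%N]).
  have [//|[Lam [sL LP cL]]] := grow T (leqnn T).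
  by have := small Lam sL LP; rewrite cL ltnn.
elim: t => [|t IH] tT; first by right; exists [::]; split; rewrite //= mul1n.
have [|[Lam [sL LP cL]]] := IH (ltnW tT); first by left.
have [H|] := boolP [forall l in P, [exists y in cube Q Lam, y * l \in cube Q Lam]].
  left; exists Lam; split=> //; first by rewrite sL ltnW.
  by move=> l lP; have /exists_inP[y] := forall_inP H l lP; exists y.
rewrite negb_forall_in => /exists_inP[l lP /exists_inPn nl]; right.
exists (l :: Lam); split; rewrite /= ?sL //.
  by move=> x; rewrite inE => /orP[/eqP->|/LP].
rewrite cardsU card_rcoset cL disjoint_setI0 ?cards0 ?subn0.
  by rewrite addnn -mul2n mulnA -expnS.
rewrite disjoint_sym disjoint_subset; apply/subsetP => _ /rcosetP[y yL ->].
exact: nl.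
Qed.
End GreedyCover.

(** * Pigeonhole on character values *)

Section Cells.

Lemma same_cell (w a b : algC) : 0 < w -> 0 <= a -> 0 <= b ->
  Num.truncn (a / w) = Num.truncn (b / w) -> `|a - b| <= w.
Proof.
move=> w0 a0 b0 ab.
have aw : 0 <= a / w by rewrite divr_ge0 // ltW.
have bw : 0 <= b / w by rewrite divr_ge0 // ltW.
have := truncn_itv bw; have := truncn_itv aw; rewrite ab => /andP[a1 a2] /andP[b1 b2].
rewrite -[a](divfK (lt0r_neq0 w0)) -[b](divfK (lt0r_neq0 w0)) -mulrBl normrM.
rewrite (gtr0_norm w0) ler_piMl //; first exact: ltW.
rewrite real_ler_norml ?rpredB ?ger0_real //; apply/andP; split.
  rewrite lerBrDr addrC lerBlDr; apply: le_trans (ltW b2) _.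
  by rewrite -natr1 lerD2r.
by rewrite lerBlDl; apply: le_trans (ltW a2) _; rewrite -natr1 lerD2r.
Qed.

Lemma truncn_bound (w a : algC) (n : nat) : 0 < w -> a <= n%:R * w ->
  (Num.truncn (a / w) <= n)%N.
Proof.
by move=> w0 aw; rewrite -[leqRHS](@natrK algC) le_truncn // ler_pdivrMr.
Qed.

Lemma norm_le_ReIm (z : algC) : `|z| <= `|'Re z| + `|'Im z|.
Proof.
by rewrite {1}[z]Crect (le_trans (ler_normD _ _)) // normrM normCi mul1r.
Qed.

Lemma norm_Re_le (z : algC) : `|'Re z| <= `|z|.
Proof. exact: leif_normC_Re_Creal. Qed.

Lemma norm_Im_le (z : algC) : `|'Im z| <= `|z|.
Proof.
rewrite -(@ler_pXn2r _ 2) ?nnegrE // (normC2_Re_Im z) real_normK ?Creal_Im //.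
by rewrite lerDr real_exprn_even_ge0 ?Creal_Re.
Qed.

(* The real and imaginary parts of [e l x] range over an interval of length
   [6 r], cut into [12 n] pieces of length [r / (2 n)]. *)
Lemma cell_count (L : eqType) (T : finType) (e : L -> T -> algC) (X : {set T})
    (n B : nat) (r : algC) (Lam : seq L) : 0 < r -> (0 < n)%N ->
    (forall l x, l \in Lam -> x \in X -> `|1 - e l x| <= 3 * r) ->
    (forall x, x \in X ->
       #|[set y in X | all (fun l => `|e l x - e l y| <= r / n%:R)%R Lam]| <= B)%N ->
  (#|X| <= (12 * n).+1 ^ (2 * size Lam) * B)%N.
Proof.
move=> r0 n0; elim: Lam X => [|l Lam IH] X near sep.
  have [->|[x xX]] := set_0Vmem X; first by rewrite cards0.
  have := sep x xX; rewrite muln0 mul1n; apply: leq_trans.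
  by apply: subset_leq_card; apply/subsetP => y yX; rewrite inE yX.
pose w : algC := r / (2 * n)%:R.
have n0' : 0 < n%:R :> algC by rewrite ltr0n.
have w0 : 0 < w by rewrite divr_gt0 // ltr0n muln_gt0.
have sw : w + w = r / n%:R by rewrite /w natrM; field; rewrite gt_eqF.
(* The shift by [3 r] moves both parts into the interval from 0 to [6 r = 12 n w], where truncation
   to a natural number is the floor. *)
pose re x := 'Re (e l x) - 1 + 3 * r.
pose im x := 'Im (e l x) + 3 * r.
have near1 x : x \in X -> `|e l x - 1| <= 3 * r.
  by move=> xX; rewrite distrC; apply: near; rewrite ?mem_head.
have Re1 x : 'Re (e l x) - 1 = 'Re (e l x - 1).
  rewrite [RHS]raddfB /=; congr (_ - _); symmetry; apply/Creal_ReP; exact: rpred1.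
have Im1 x : 'Im (e l x) = 'Im (e l x - 1).
  rewrite [RHS]raddfB /= -[LHS]subr0; congr (_ - _); symmetry; apply/Creal_ImP; exact: rpred1.
have rangeP a : a \is Num.real -> `|a| <= 3 * r -> 0 <= a + 3 * r <= (12 * n)%:R * w.
  move=> ar; rewrite real_ler_norml // => /andP[a1 a2].
  rewrite -lerBlDr sub0r a1 /= (le_trans (lerD a2 (lexx _))) //.
  by rewrite le_eqVlt (_ : _ + _ = (12 * n)%:R * w) ?eqxx // /w !natrM; field; rewrite gt_eqF.
have reP x : x \in X -> 0 <= re x <= (12 * n)%:R * w.
  move=> xX; rewrite /re Re1 rangeP ?Creal_Re //.
  exact: le_trans (norm_Re_le _) (near1 x xX).
have imP x : x \in X -> 0 <= im x <= (12 * n)%:R * w.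
  move=> xX; rewrite /im Im1 rangeP ?Creal_Im //.
  exact: le_trans (norm_Im_le _) (near1 x xX).
pose cell x : 'I_(12 * n).+1 * 'I_(12 * n).+1 :=
  (inord (Num.truncn (re x / w)), inord (Num.truncn (im x / w))).
have cellP x y : x \in X -> y \in X -> cell x = cell y ->
    `|e l x - e l y| <= r / n%:R.
  move=> xX yX [/(congr1 val) /= c1 /(congr1 val) /= c2].
  have /andP[rx rx'] := reP x xX; have /andP[ry ry'] := reP y yX.
  have /andP[ix ix'] := imP x xX; have /andP[iy iy'] := imP y yX.
  rewrite !inordK ?ltnS ?truncn_bound // in c1 c2.
  have := same_cell w0 rx ry c1; have := same_cell w0 ix iy c2.
  rewrite /re /im -sw => dim dre; apply: le_trans (norm_le_ReIm _) _.
  rewrite !raddfB /=; apply: lerD.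
    by apply: le_trans dre; rewrite le_eqVlt; apply/orP; left; apply/eqP; congr `|_|; ring.
  by apply: le_trans dim; rewrite le_eqVlt; apply/orP; left; apply/eqP; congr `|_|; ring.
(* Within one cell the closeness condition at [l] holds automatically, so the induction hypothesis
   for [Lam] applies. *)
have piece c : (#|[set x in X | cell x == c]| <= (12 * n).+1 ^ (2 * size Lam) * B)%N.
  apply: IH => [k x kL|x].
    by rewrite inE => /andP[xX _]; apply: near xX; rewrite inE kL orbT.
  rewrite inE => /andP[xX /eqP cx]; apply: leq_trans (sep x xX).
  apply: subset_leq_card; apply/subsetP => y; rewrite !inE /= => /andP[/andP[yX /eqP cy] ->].
  by rewrite yX cellP // cx cy.
have -> : #|X| = (\sum_c #|[set x in X | cell x == c]|)%N.
  rewrite -sum1_card (partition_big cell xpredT) //=.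
  by apply: eq_bigr => c _; rewrite -sum1_card; apply: eq_bigl => x; rewrite inE.
apply: leq_trans (leq_sum _ (fun c _ => piece c)) _.
by rewrite sum_nat_const card_prod !card_ord /= (mulnS 2) expnD -mulnn mulnA.
Qed.
End Cells.

(** * Size of Bohr sets *)

Section BallSize.
Variables (gT : finGroupType) (H : {group gT}) (P : {set Iirr H}).

(* Bessel's inequality for the indicator function of [B]. *)
Lemma bohr_card_le (B : {set gT}) : B \subset H -> H \subset 'N(B)%g -> 1%g \in B ->
    (forall i x, i \in P -> x \in B -> `|1 - 'chi_i x| <= 16%:R^-1) ->
  (#|P| * #|B| <= 4 * #|H|)%N.
Proof.
move=> BH nBH B1 small; have nB : (B <| H)%g by apply/andP.
have B0 : 0 < #|B|%:R :> algC by rewrite ltr0n; apply/card_gt0P; exists 1%g.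
have H0 : 0 < #|H|%:R :> algC by rewrite ltr0n cardG_gt0.
have norm1 : '['1_B : 'CF(H)] = #|B|%:R / #|H|%:R.
  rewrite cfdotE mulrC; congr (_ / _); rewrite -sum1_card natr_sum.
  rewrite big_mkcond [RHS]big_mkcond; apply: eq_bigr => x _.
  rewrite cfuniE //; case: (boolP (x \in B)) => xB; last by rewrite mul0r if_same.
  by rewrite (subsetP BH) // conjC_nat mul1r.
(* The values on [B] lie within 1/2 of 1, so their sum has norm at least [|B|/2]. *)
have coef i : i \in P -> (#|B|%:R / #|H|%:R / 2) ^+ 2 <= `|'['1_B, 'chi_i]| ^+ 2.
  move=> iP; rewrite ler_pXn2r ?nnegrE ?divr_ge0 ?ler0n //.
  rewrite cfdotE normrM normfV normr_nat mulrAC [leRHS]mulrC.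
  rewrite ler_wpM2r ?invr_ge0 ?ler0n //.
  have -> : \sum_(x in H) ('1_B : 'CF(H)) x * ('chi_i x)^* = (\sum_(x in B) 'chi_i x)^*.
    rewrite rmorph_sum big_mkcond [RHS]big_mkcond; apply: eq_bigr => x _.
    rewrite cfuniE //; case: (boolP (x \in B)) => xB; last by rewrite mul0r if_same.
    by rewrite (subsetP BH) // mul1r.
  rewrite norm_conjC; have close : `|#|B|%:R - \sum_(x in B) 'chi_i x| <= #|B|%:R / 2.
    rewrite -sumr_const -sumrB mulr_suml; apply: le_trans (ler_norm_sum _ _ _) _.
    apply: ler_sum => x xB; apply: le_trans (small i x iP xB) _.
    by rewrite mul1r lef_pV2 ?posrE ?ltr0n // ler_nat.
  have := lerB_dist #|B|%:R (\sum_(x in B) 'chi_i x).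
  rewrite normr_nat => /le_trans/(_ close); rewrite lerBlDr -lerBlDl.
  by apply: le_trans; rewrite le_eqVlt; apply/orP; left; apply/eqP; field.
have : #|P|%:R * (#|B|%:R / #|H|%:R / 2) ^+ 2 <= #|B|%:R / #|H|%:R :> algC.
  rewrite mulr_natl -sumr_const -[leRHS]norm1 cfdot_sum_irr.
  rewrite [leRHS](bigID (mem P)) /= -[leLHS]addr0 lerD //.
    by apply: ler_sum => i iP; rewrite -[leRHS]normCK; apply: coef.
  by apply: sumr_ge0 => i _; rewrite -[leRHS]normCK exprn_ge0.
rewrite (_ : _ * _ = #|B|%:R / #|H|%:R * ((#|P|%:R * #|B|%:R) / (4 * #|H|%:R))); last first.
  by field; rewrite gt_eqF.
rewrite -[leRHS]mulr1 ler_pM2l ?divr_gt0 // ler_pdivrMr ?mulr_gt0 ?ltr0n // mul1r.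
by rewrite -!natrM ler_nat.
Qed.
End BallSize.

(** [algC] is only partially ordered, so the maximum is built along an enumeration, with 0 for empty
    [P]. *)
Lemma fin_max_attained (I : finType) (P : {set I}) (f : I -> algC) :
    (forall i, 0 <= f i) ->
  exists c, [/\ 0 <= c, {in P, forall i, f i <= c}
              & c = 0 \/ exists2 i, i \in P & c = f i].
Proof.
move=> f0; suff [c [c0 fc cP]] : exists c, [/\ 0 <= c, {in enum P, forall i, f i <= c}
    & c = 0 \/ exists2 i, i \in enum P & c = f i].
  exists c; split=> // [i iP|]; first by rewrite fc ?mem_enum.
  by case: cP => [|[i iP ->]]; [left|right; exists i; rewrite // -mem_enum].
elim: (enum P) => [|i s [c [c0 fc cP]]]; first by exists 0; split=> //; left.
have [fic|cfi] := real_leP (ger0_real (f0 i)) (ger0_real c0).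
  exists c; split=> // [j|]; first by rewrite inE => /orP[/eqP->|/fc].
  by case: cP => [|[j js ->]]; [left|right; exists j; rewrite // inE js orbT].
exists (f i); split=> // [j|]; last by right; exists i; rewrite ?mem_head.
by rewrite inE => /orP[/eqP->|/fc/le_trans->]; rewrite ?lexx ?ltW.
Qed.

(** * Spectrum balls in the dual group and their Bohr sets *)

Section DualBall.
Variables (gT : finGroupType) (H : {group gT}) (A : {set gT}) (m T : nat).
Hypotheses (AH : <<A>>%g = H) (nAH : H \subset 'N(A)%g) (A1 : 1%g \in A).
Hypothesis AV : A^-1%g = A.
Hypothesis slow : (64 * #|prodset A m.+1| <= 65 * #|prodset A m|)%N.
Hypothesis monH : monomial H.
Hypothesis T0 : (0 < T)%N.

Let S := prodset A m.
(* With [b + 1 = 32 (T + 1)^2], a character outside the core has squared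
   coefficient at most [b / (b + 1)], whose [b T]-th power is at most [2^-T]. *)
Let k := ((32 * T.+1 ^ 2).-1 * T).+1.
Hypothesis growth : (4 * #|prodset S k| < 2 ^ T * #|S|)%N.

(** The dual group of [H] as an abstract group [L], so that [greedy_cover] applies; [cF] reads its
    elements as linear characters. *)
Variables (L : finGroupType) (cF : L -> 'CF(H)).
Hypotheses (cFinj : injective cF) (cFlin : forall u, cF u \is a linear_char).
Hypothesis cFonto : forall phi : 'CF(H), phi \is a linear_char -> exists u, phi = cF u.
Hypothesis cFM : {morph cF : u v / (u * v)%g >-> u * v}.

Let subAH : A \subset H. Proof. by rewrite -AH subset_gen. Qed.
Let SH : S \subset H. Proof. exact: prodset_subgroup. Qed.
Let nSH : H \subset 'N(S)%g. Proof. exact: prodset_norm. Qed.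
Let S1 : 1%g \in S. Proof. exact: prodset_id. Qed.
Let SV : S^-1%g = S. Proof. exact: (prodset_inv _ subAH nAH AV). Qed.

(** A product of [T + 1] characters of spread at most [tau] has spread at most 1, hence squared
    coefficient at least 1/2. *)
Let tau : algC := (T.+1%:R ^+ 2)^-1.

Definition spectrum_ball : {set L} := [set u | spread S (cF u) <= tau].
(** Spread grows quadratically under products, so [16 = 4^2] keeps fourth powers in the ball. *)
Definition spectrum_core : {set L} := [set u | spread S (cF u) <= tau / 16%:R].

Local Notation P := spectrum_ball.
Local Notation Q := spectrum_core.

Let tau0 : 0 < tau.
Proof. by rewrite invr_gt0 exprn_gt0 ?ltr0n. Qed.

Let tau1 : tau <= 1.
Proof. by rewrite invf_le1 ?exprn_gt0 ?ltr0n // exprn_ege1 // ler1n. Qed.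

Let idx u : Iirr H := cfIirr (cF u).
Let idxE u : 'chi_(idx u) = cF u.
Proof. by rewrite cfIirrE // lin_char_irr. Qed.
Let idx_inj : injective idx.
Proof. by move=> u v uv; apply: cFinj; rewrite -!idxE uv. Qed.

Let spread_idx u : spread S (cF u) = 2 - 2 * fhat S (idx u) ^+ 2.
Proof. by rewrite -idxE spreadE // idxE. Qed.

Lemma spectrum_card_le (W : {set L}) :
  {in W, forall u, spread S (cF u) <= 1} -> (#|W| * #|S| <= 2 * #|H|)%N.
Proof.
move=> HW; rewrite -(card_imset _ idx_inj).
apply: (large_spectrum_le SH nSH S1 SV) => _ /imsetP[u /HW su ->].
move: su; rewrite spread_idx lerBlDr -lerBlDl (_ : 2 - 1 = 1); last by ring.
by rewrite mulrC -ler_pdivrMr ?ltr0n // mul1r.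
Qed.

Lemma spectrum_core_card_ge : (#|H| <= 2 * #|prodset S k| * #|Q|)%N.
Proof.
pose b := (32 * T.+1 ^ 2).-1.
have bE : b.+1 = (32 * T.+1 ^ 2)%N by rewrite prednK // muln_gt0 expn_gt0.
have b0 : (0 < b)%N by rewrite -ltnS bE (leq_trans (_ : 1 < 32 * 1)%N) // leq_mul2l expn_gt0.
have nonlin (i : Iirr H) : 'chi_i \isn't a linear_char -> fhat S i ^+ 2 <= 2^-1.
  exact: nonlinear_fhat.
have small : (2 * #|prodset S (b * T).+1| <= 2 ^ T * #|S|)%N.
  by apply: leq_trans (ltnW growth); rewrite leq_mul2r orbT.
apply: leq_trans (large_spectrum_ge SH nSH S1 SV b0 nonlin small) _.
rewrite leq_mul2l -(card_imset _ idx_inj); apply/orP; right.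
apply: subset_leq_card; apply/subsetP => i; rewrite inE => /andP[lini fi].
have [u Du] := cFonto lini; apply/imsetP; exists u; last first.
  by apply: irr_inj; rewrite idxE.
rewrite inE -Du spreadE // lerBlDr -lerBlDl.
(* Spread [tau/16] corresponds to squared coefficient [1 - tau/32], which is [b/(b + 1)]. *)
have -> : 2 - tau / 16%:R = 2 * (b%:R / b.+1%:R).
  have -> : tau / 16%:R = 2 / b.+1%:R.
    by rewrite /tau bE natrM natrX -[32%N]/(2 * 16)%N natrM; field; rewrite ?natr1 ?nat1r ?pnatr_eq0.
  by rewrite -[b.+1%:R]natr1; field; rewrite ?natr1 ?nat1r ?pnatr_eq0.
by rewrite ler_pM2l ?ltr0n.
Qed.

Lemma core_sub_ball : Q \subset P.
Proof.
apply/subsetP => u; rewrite !inE => /le_trans; apply.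
by rewrite ler_pdivrMr ?ltr0n // ler_peMr ?ler1n // ltW.
Qed.

Lemma core_sqr u : u \in Q -> (u * u)%g \in P /\ (u * u * (u * u))%g \in P.
Proof.
rewrite inE => su.
have s2 : spread S (cF (u * u)%g) <= 2 ^+ 2 * (tau / 16%:R).
  by rewrite cFM; apply: spreadM; rewrite ?expr1n ?mul1r.
have s4 : spread S (cF (u * u * (u * u))%g) <= 2 ^+ 2 * (2 ^+ 2 * (tau / 16%:R)).
  by rewrite cFM; apply: spreadM; rewrite ?expr1n ?mul1r.
rewrite !inE; split; [apply: le_trans s2 _|apply: le_trans s4 _].
  rewrite mulrCA ler_piMr ?(ltW tau0) // ler_pdivrMr ?ltr0n // mul1r.
  by rewrite -natrX ler_nat.
rewrite (_ : _ * _ = tau) //; first by field.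
Qed.

Lemma cube_spread Lam y : {subset Lam <= P} -> y \in cube Q Lam ->
  spread S (cF y) <= (size Lam).+1%:R ^+ 2 * tau.
Proof.
elim: Lam y => [|l Lam IH] y LP /=.
  by move/(subsetP core_sub_ball); rewrite inE expr1n mul1r.
have LP' : {subset Lam <= P} by move=> x xL; apply: LP; rewrite inE xL orbT.
rewrite inE => /orP[/(IH _ LP')/le_trans->//|/rcosetP[x xL ->]].
  by rewrite ler_wpM2r ?(ltW tau0) // lerXn2r ?nnegrE ?ler0n // ler_nat.
rewrite cFM; apply: spreadM => //; first exact: IH.
by have := LP l (mem_head _ _); rewrite inE.
Qed.

(** The cube has spread at most [(T + 1)^2 tau = 1], so it has at most [2|H|/|S|] elements. As
    [|H| <= 2 |S^k| |Q|], this is at most [4 |S^k| |Q| / |S|], and [growth] concludes. *)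
Lemma cube_card Lam : size Lam = T -> {subset Lam <= P} ->
  (#|cube Q Lam| < 2 ^ T * #|Q|)%N.
Proof.
move=> sL LP.
have c2 : (#|cube Q Lam| * #|S| <= 2 * #|H|)%N.
  apply: spectrum_card_le => y /(cube_spread LP)/le_trans; apply.
  by rewrite sL /tau mulfV // expf_neq0 // pnatr_eq0.
have S0 : (0 < #|S|)%N by apply/card_gt0P; exists 1%g.
have Q0 : (0 < #|Q|)%N.
  have := leq_trans (cardG_gt0 H) spectrum_core_card_ge.
  by rewrite muln_gt0 => /andP[].
rewrite -(ltn_pmul2r S0); apply: leq_ltn_trans c2 _.
apply: (@leq_ltn_trans (2 * (2 * #|prodset S k| * #|Q|))).
  by rewrite leq_mul2l spectrum_core_card_ge orbT.
by rewrite !mulnA [X in (_ < X)%N]mulnAC ltn_pmul2r.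
Qed.

(** * Distances to 1 and their control by few characters *)

Let dist u x : algC := `|1 - cF u x|.

Let dist_ge0 u x : 0 <= dist u x. Proof. exact: normr_ge0. Qed.

Lemma distM u v x : x \in H -> dist (u * v)%g x <= dist u x + dist v x.
Proof.
move=> xH; rewrite /dist cFM cfunE.
rewrite (_ : _ - _ = (1 - cF u x) + cF u x * (1 - cF v x)); last by ring.
by rewrite (le_trans (ler_normD _ _)) // normrM normC_lin_char // mul1r.
Qed.

(** Factor [1 - u^2 = (1 + u)(1 - u)]; the first factor has norm at least [2 - 1/4]. *)
Lemma dist_sqr u x : x \in H -> dist u x <= 4%:R^-1 ->
  7%:R / 4%:R * dist u x <= dist (u * u)%g x.
Proof.
move=> xH; rewrite /dist cFM cfunE => small.
rewrite (_ : 1 - _ * _ = (1 + cF u x) * (1 - cF u x)); last by ring.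
rewrite normrM ler_wpM2r //.
have := lerB_dist 2 (1 - cF u x); rewrite normr_nat.
rewrite (_ : 2 - (1 - _) = 1 + cF u x); last by ring.
apply: le_trans; rewrite lerBrDr -lerBrDl.
by rewrite (_ : 2 - _ = 4%:R^-1) //; field.
Qed.

(* The characters of [Q] and their squares and fourth powers lie in [P], so no
   wrapping around the circle occurs and [dist] grows when squaring. *)
Lemma dist_core (c : algC) x : x \in H -> {in P, forall u, dist u x <= c} ->
  c <= 4%:R^-1 -> {in Q, forall u, dist u x <= 16%:R / 49%:R * c}.
Proof.
move=> xH Pc c4 u uQ; have [u2 u4] := core_sqr uQ.
have uP := subsetP core_sub_ball u uQ.
have s1 := dist_sqr xH (le_trans (Pc _ uP) c4).
have s2 := dist_sqr xH (le_trans (Pc _ u2) c4).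
have h : 0 <= 7%:R / 4%:R :> algC by rewrite divr_ge0 ?ler0n.
have := le_trans (le_trans (ler_wpM2l h s1) s2) (Pc _ u4).
rewrite mulrA => s.
have h' : 0 <= 16%:R / 49%:R :> algC by rewrite divr_ge0 ?ler0n.
apply: le_trans (ler_wpM2l h' s); rewrite mulrA.
by rewrite (_ : 16%:R / 49%:R * _ = 1) ?mul1r //; field.
Qed.

(** Let [c] be the largest distance over [P]. On the cube distances are at most [16/49 c + T r], and
    each [u] in [P] is a quotient of two cube elements. So [c <= 32/49 c + 2 T r], and
    [98/17 <= 6]. *)
Lemma dist_net : exists Lam : seq L, [/\ (size Lam <= T)%N, {subset Lam <= P} &
  forall x r, x \in H -> {in P, forall u, dist u x <= 4%:R^-1} -> 0 <= r ->
    {in Lam, forall l, dist l x <= r} ->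
  {in P, forall u, dist u x <= 6%:R * T%:R * r}].
Proof.
have [Lam [sL LP cov]] := greedy_cover cube_card.
exists Lam; split=> // x r xH P4 r0 Lr.
have [c [c0 Pc cE]] := fin_max_attained P (f := dist^~ x) (fun=> normr_ge0 _).
case: cE => [c00|[u uP cu]].
  by move=> u /Pc/le_trans; apply; rewrite c00 !mulr_ge0 ?ler0n.
have Qc := dist_core xH Pc (_ : c <= _); rewrite cu in Qc; have {}Qc := Qc (P4 u uP).
rewrite -cu in Qc.
have sumL : \sum_(l <- Lam) dist l x <= T%:R * r.
  apply: (@le_trans _ _ (\sum_(l <- Lam) r)).
    by rewrite big_seq [leRHS]big_seq; apply: ler_sum => l /Lr.
  by rewrite big_const_seq count_predT iter_addr_0 -[r *+ _]mulr_natl ler_wpM2r // ler_nat.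
have cubec y : y \in cube Q Lam -> dist y x <= 16%:R / 49%:R * c + T%:R * r.
  move=> yL; have := @cube_ind _ Q Lam (dist^~ x) _ _ _ Qc y yL.
  move=> /(_ (fun u v => distM u v xH) (fun=> normr_ge0 _))/le_trans; apply.
  by rewrite lerD2l.
have [y yL yuL] := cov u uP.
have cle : c <= 2 * (16%:R / 49%:R * c + T%:R * r).
  have e : dist u x = `|(1 - cF (y * u)%g x) - (1 - cF y x)|.
    rewrite cFM cfunE (_ : _ - _ - _ = cF y x * (1 - cF u x)); last by ring.
    by rewrite normrM normC_lin_char // mul1r.
  rewrite cu [leLHS]e (le_trans (ler_normB _ _)) // -cu mulrDl mul1r.
  by apply: lerD; apply: cubec.
have c6 : c <= 6%:R * T%:R * r.
  move: cle; rewrite mulrDr -lerBlDl (_ : c - _ = 17%:R / 49%:R * c); last by field.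
  have h : 0 <= 49%:R / 17%:R :> algC by rewrite divr_ge0 ?ler0n.
  move=> /(ler_wpM2l h); rewrite mulrA (_ : _ / _ * _ = 1) ?mul1r; last by field.
  move/le_trans; apply; rewrite (_ : _ / _ * _ = 98%:R / 17%:R * (T%:R * r)); last by field.
  rewrite -[leRHS]mulrA ler_wpM2r ?mulr_ge0 ?ler0n // ler_pdivrMr ?ltr0n //.
  by rewrite -natrM ler_nat.
by move=> v /Pc/le_trans; apply.
Qed.

Lemma dist_gen u a : u \in P -> a \in A -> dist u a <= 16%:R^-1.
Proof.
rewrite inE => su aA; rewrite /dist; apply: (slow_close AH A1 slow) => //.
have := le_trans su tau1; rewrite spread_lin // lerBlDr -lerBlDl.
rewrite (_ : 2 - 1 = 1); last by ring.
rewrite mulrC -ler_pdivrMr ?ltr0n // mul1r.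
set c := _ / _ => c2; have c0 : 0 <= c ^+ 2.
  by apply: le_trans c2; rewrite invr_ge0 ler0n.
rewrite -(@ler_pXn2r _ 2) ?nnegrE ?invr_ge0 ?ler0n // -normrX (ger0_norm c0).
apply: le_trans c2; rewrite expr2 ler_piMr ?invr_ge0 ?ler0n //.
by rewrite invf_le1 ?ltr0n // ler1n.
Qed.

Lemma distV u x : x \in H -> dist u x^-1%g = dist u x.
Proof.
move=> xH; rewrite /dist lin_charV // -norm_conjC rmorphB rmorph1 /= invC_norm.
by rewrite normC_lin_char // expr1n invr1 mul1r conjCK.
Qed.

Lemma dist_quot u x y : x \in H -> y \in H ->
  dist u (x^-1 * y)%g = `|cF u x - cF u y|.
Proof.
move=> xH yH; have <- : `|cF u x| * dist u (x^-1 * y)%g = `|cF u x - cF u y|.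
  rewrite -normrM mulrBr mulr1 lin_charM ?groupV // lin_charV //.
  by rewrite mulrA divff ?mul1r // -normr_eq0 normC_lin_char // oner_eq0.
by rewrite normC_lin_char // mul1r.
Qed.

Lemma dist_mul u x y : x \in H -> y \in H -> dist u (x * y)%g <= dist u x + dist u y.
Proof.
move=> xH yH; rewrite -(distV u xH) -{1}[x]invgK dist_quot ?groupV //.
have -> : cF u x^-1%g - cF u y = (1 - cF u y) - (1 - cF u x^-1%g) by ring.
by rewrite [leRHS]addrC ler_normB.
Qed.

(** Bessel bounds [|B|] by [4|H|/|P|], and [P] contains the core, which has at least [|H|/(2|S^k|)]
    elements. *)
Lemma ball_card_le (B : {set gT}) : B \subset H -> H \subset 'N(B)%g -> 1%g \in B ->
    (forall u x, u \in P -> x \in B -> dist u x <= 16%:R^-1) ->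
  (#|B| <= 8 * #|prodset S k|)%N.
Proof.
move=> BH nBH B1 small.
have cB : (#|P| * #|B| <= 4 * #|H|)%N.
  rewrite -(card_imset P idx_inj); apply: (bohr_card_le BH nBH B1).
  by move=> _ x /imsetP[u uP ->] xB; rewrite idxE; apply: small.
have QP := subset_leq_card core_sub_ball; have HQ := spectrum_core_card_ge.
have P0 : (0 < #|P|)%N.
  have := leq_trans (cardG_gt0 H) HQ; rewrite muln_gt0 => /andP[_ Q0].
  exact: leq_trans Q0 QP.
rewrite -(leq_pmul2l P0) (leq_trans cB) //.
apply: (@leq_trans (4 * (2 * #|prodset S k| * #|P|))).
  by rewrite leq_mul2l (leq_trans HQ) // leq_mul2l QP orbT.
by rewrite !mulnA mulnC mulnA.
Qed.

(** Cells are cut for the net [Lam] only, with [n = 6 T]. Two close points of [X] have a quotient at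
    distance at most [r/(6 T)] on [Lam], hence at most [r] on [P], so each piece translates into the
    [r]-ball. The bound 1/8 on [X] gives the 1/4 that [dist_net] asks of quotients. *)
Lemma ball_doubling (X : {set gT}) (r : algC) : 0 < r -> X \subset H ->
    (forall u x, u \in P -> x \in X -> dist u x <= 3 * r) ->
    (forall u x, u \in P -> x \in X -> dist u x <= 8%:R^-1) ->
  (#|X| <= (12 * (6 * T)).+1 ^ (2 * T)
            * #|[set x in H | [forall u in P, (dist u x <= r)%R]]|)%N.
Proof.
move=> r0 XH X3 X8; have [Lam [sL LP net]] := dist_net.
set B := [set x in H | _].
have n0 : (0 < 6 * T)%N by rewrite muln_gt0.
apply: leq_trans (cell_count (e := fun u x => cF u x) (B := #|B|) (Lam := Lam) r0 n0 _ _) _.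
- by move=> l x lL xX; apply: X3 (LP _ lL) xX.
- move=> x xX; have xH := subsetP XH _ xX.
  rewrite -(card_lcoset _ x^-1%g); apply: subset_leq_card.
  apply/subsetP => _ /lcosetP[y /[!inE] /andP[yX /allP near] ->].
  have yH := subsetP XH _ yX; have zH : (x^-1 * y)%g \in H by rewrite groupM ?groupV.
  rewrite zH; apply/forall_inP => u uP.
  rewrite (_ : r = 6%:R * T%:R * (r / (6 * T)%:R)); last first.
    by rewrite natrM; field; rewrite pnatr_eq0 -lt0n.
  apply: net => // [v vP||l lL].
  + rewrite (le_trans (dist_mul _ _ _)) ?groupV // distV //.
    rewrite (le_trans (lerD (X8 _ _ vP xX) (X8 _ _ vP yX))) //.
    by rewrite le_eqVlt; apply/orP; left; apply/eqP; field.
  + by rewrite divr_ge0 ?ler0n // ltW.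
  + by rewrite dist_quot //; apply: near.
- by rewrite leq_mul2r leq_pexp2l ?orbT // leq_mul2l sL orbT.
Qed.

(** * Conjugation invariance and the integer-valued height *)

Lemma ball_conj u y : u \in P -> y \in 'N(A)%g ->
  exists2 v, v \in P & forall x, dist v x = dist u (x ^ y^-1)%g.
Proof.
rewrite inE => su yA; have [v Dv] := cFonto (cfConjg_lin_char y (cFlin u)).
have yS : y \in 'N(S)%g by rewrite -cycle_subG prodset_norm // cycle_subG.
have yH : y \in 'N(H)%g by rewrite -AH (subsetP (norm_gen A)).
exists v => [|x]; first by rewrite inE -Dv spread_conj.
by rewrite /dist -Dv cfConjgE.
Qed.

(* Rounding up to integers keeps the triangle inequality and turns algebraic
   numbers into natural ones. *)
Definition height (M : nat) (x : gT) : nat :=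
  (\max_(u in P) `|Num.ceil (M%:R * dist u x)%R|)%N.

Lemma height_le M x j :
  (height M x <= j)%N = [forall u in P, M%:R * dist u x <= j%:R].
Proof.
have ceil_le u : (`|Num.ceil (M%:R * dist u x)%R| <= j)%N = (M%:R * dist u x <= j%:R).
  have d0 : 0 <= M%:R * dist u x by rewrite mulr_ge0 ?ler0n ?dist_ge0.
  rewrite -lez_nat gez0_abs; last by rewrite real_ceil_ge0 ?ger0_real // (lt_le_trans _ d0) // oppr_lt0.
  by rewrite real_ceil_le_int ?ger0_real // -pmulrn.
by apply/bigmax_leqP/forall_inP => le u uP; have := le u uP; rewrite ceil_le.
Qed.

Lemma heightP M x u : u \in P -> M%:R * dist u x <= (height M x)%:R.
Proof. by move=> uP; have := leqnn (height M x); rewrite height_le => /forall_inP; apply. Qed.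

Lemma height1 M : height M 1%g = 0%N.
Proof.
apply/eqP; rewrite -leqn0 height_le; apply/forall_inP => u _.
by rewrite /dist lin_char1 // subrr normr0 mulr0.
Qed.

Lemma heightV M x : x \in H -> height M x^-1%g = height M x.
Proof. by move=> xH; apply: eq_bigr => u _; rewrite distV. Qed.

Lemma heightM M x y : x \in H -> y \in H ->
  (height M (x * y)%g <= height M x + height M y)%N.
Proof.
move=> xH yH; rewrite height_le; apply/forall_inP => u uP.
rewrite natrD (le_trans (ler_wpM2l _ (dist_mul u xH yH))) ?ler0n // mulrDr.
by rewrite lerD // heightP.
Qed.

Lemma heightJ M x y : y \in 'N(A)%g -> height M (x ^ y)%g = height M x.
Proof.
have le z w : z \in 'N(A)%g -> (height M (w ^ z)%g <= height M w)%N.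
  move=> zA; rewrite height_le; apply/forall_inP => u uP.
  have [v vP Dv] := ball_conj uP (groupVr zA).
  by have := heightP M w vP; rewrite Dv invgK.
move=> yA; apply/eqP; rewrite eqn_leq le // -{1}[x](conjgK y) le ?groupV //.
Qed.

Lemma height_le_diam M x : x \in H -> (height M x <= 2 * M)%N.
Proof.
move=> xH; rewrite height_le; apply/forall_inP => u _.
rewrite natrM mulrC ler_wpM2r ?ler0n // /dist (le_trans (ler_normB _ _)) //.
by rewrite normr1 normC_lin_char.
Qed.

(** Take [N] at least every reciprocal of a nonzero distance. This settles radius 0, whose doubled
    ball may have integer radius 1. *)
Lemma height_separates : exists N : nat, (0 < N)%N /\
  forall x, x \in H -> (height (16 * N) x <= 1)%N -> height (16 * N) x = 0%N.
Proof.
pose bd (xu : gT * L) := Num.bound (dist xu.2 xu.1)^-1.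
pose N := (\max_xu bd xu).+1; exists N; split=> // x xH.
rewrite height_le => /forall_inP h1; apply/eqP; rewrite -leqn0 height_le.
apply/forall_inP => u uP; have := h1 u uP.
have [->|dn0] := eqVneq (dist u x) 0; first by rewrite mulr0.
have d0 : 0 < dist u x by rewrite lt0r dn0 dist_ge0.
rewrite -ler_pdivlMr // mul1r => bad; exfalso.
have : ((16 * N)%:R : algC) < (bd (x, u))%:R.
  by apply: le_lt_trans bad _; rewrite archi_boundP // invr_ge0 ltW.
rewrite ltr_nat ltnNge => /negP[].
apply: (@leq_trans N); last by rewrite leq_pmull.
by rewrite leqW // (leq_bigmax (x, u)).
Qed.

Lemma dual_ball : exists (h : gT -> nat) (N : nat),
  [/\ (0 < N)%N, h 1%g = 0%N, {in H, forall x, h x^-1%g = h x},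
      {in H &, forall x y, h (x * y)%g <= h x + h y}%N &
      forall x y, y \in 'N(A)%g -> h (x ^ y)%g = h x] /\
  [/\ {in H, forall x, h x <= 32 * N}%N, {in A, forall x, h x <= N}%N,
      (#|[set x in H | h x <= N]| <= 8 * #|prodset S k|)%N &
      forall p p2 : nat, (p2 <= 2 * N)%N -> (p2 <= (2 * p).+1)%N ->
        (#|[set x in H | h x <= p2]|
           <= (72 * T).+1 ^ (2 * T) * #|[set x in H | h x <= p]|)%N].
Proof.
(* At scale [16 N] the bound 1/16 on [A] becomes height [N], and the diameter 2 becomes [32 N]. *)
have [N [N0 sep]] := height_separates; exists (height (16 * N)), N.
have M0 : 0 < (16 * N)%:R :> algC by rewrite ltr0n muln_gt0.
split; split=> //.
- exact: height1.
- by move=> x; apply: heightV.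
- by move=> x y; apply: heightM.
- by move=> x y; apply: heightJ.
- by move=> x /(height_le_diam (16 * N)); rewrite mulnA.
- move=> a aA; rewrite height_le; apply/forall_inP => u uP.
  rewrite mulrC -ler_pdivlMr // (le_trans (dist_gen uP aA)) //.
  by rewrite natrM invfM mulrCA mulfV ?mulr1 // pnatr_eq0 -lt0n.
- apply: ball_card_le.
  + by apply/subsetP => x; rewrite inE => /andP[].
  + apply/subsetP => y yH; rewrite inE; apply/subsetP => _ /imsetP[x xB ->].
    by move: xB; rewrite !inE groupJr // heightJ // (subsetP nAH).
  + by rewrite inE group1 height1.
  + move=> u x uP; rewrite inE => /andP[xH hx].
    have := le_trans (heightP (16 * N) x uP) (_ : _ <= N%:R); rewrite ler_nat => /(_ hx).
    rewrite natrM mulrAC -[leRHS]mul1r ler_pM2r ?ltr0n // mulrC -ler_pdivlMr ?ltr0n //.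
    by rewrite mul1r.
(* For [p = 0] separation makes the two balls equal. For [p >= 1], [2 p + 1 <= 3 p] gives the [3 r]
   of the cell count, and [p2 <= 2 N] gives distances at most 1/8. *)
move=> p p2 p2N p2p; case: (posnP p) p2p => [-> p21|p0 p2p].
  rewrite (leq_trans _ (leq_pmull _ _)) ?expn_gt0 //.
  apply: subset_leq_card; apply/subsetP => x; rewrite !inE => /andP[xH hx].
  by rewrite xH sep // (leq_trans hx).
have p23 : (p2 <= 3 * p)%N.
  by rewrite (leq_trans p2p) // (mulSn 2) -addn1 addnC leq_add2r.
set X := [set x in H | _]; set r : algC := p%:R / (16 * N)%:R.
have XH : X \subset H by apply/subsetP => x; rewrite inE => /andP[].
have r0 : 0 < r by rewrite divr_gt0 // ltr0n.
have Xd u x : u \in P -> x \in X -> dist u x <= p2%:R / (16 * N)%:R.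
  move=> uP; rewrite inE => /andP[_ hx]; rewrite ler_pdivlMr // mulrC.
  by rewrite (le_trans (heightP _ _ uP)) // ler_nat.
have := @ball_doubling X r r0 XH.
rewrite mulnA [(12 * 6)%N]/= => dbl; apply: leq_trans (dbl _ _) _.
- move=> u x uP xX; rewrite (le_trans (Xd u x uP xX)) // mulrA ler_wpM2r ?invr_ge0 ?ler0n //.
  by rewrite -natrM ler_nat.
- move=> u x uP xX; rewrite (le_trans (Xd u x uP xX)) // ler_pdivrMr //.
  rewrite mulrC ler_pdivlMr ?ltr0n // -natrM ler_nat mulnC.
  by rewrite -[16%N]/(8 * 2)%N -mulnA leq_mul2l p2N orbT.
rewrite leq_mul2l; apply/orP; right; apply: subset_leq_card.
apply/subsetP => x; rewrite !inE => /andP[-> /forall_inP xr] /=.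
rewrite height_le; apply/forall_inP => u uP.
by rewrite mulrC -ler_pdivlMr //; apply: xr.
Qed.
End DualBall.

(** * Choice of parameters and the height function on [G] *)

(** Both [m] and [k] are polynomial in [d <= 2^l]: their product is at most [2^(35 + 8 l)], and
    [T = 64 d l] absorbs its [d]-th power together with the factor 4. *)
Lemma scale_bounds (d l m : nat) (T := (64 * d * l)%N)
    (k := ((32 * T.+1 ^ 2).-1 * T).+1) :
    (0 < d)%N -> (0 < l)%N -> (d <= 2 ^ l)%N -> (m <= 1024 * d ^ 2)%N ->
  (4 * (m * k) ^ d < 2 ^ T)%N /\ ((72 * T).+1 <= 2 ^ (15 * l))%N.
Proof.
move=> d0 l0 dl md.
have T0 : (0 < T)%N by rewrite !muln_gt0 d0 l0.
have Tl : (T <= 2 ^ (6 + 2 * l))%N.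
  rewrite /T -mulnA expnD leq_mul2l /= mul2n -addnn expnD leq_mul //.
  by rewrite ltnW // ltn_expl.
have kl : (k <= 2 ^ (25 + 6 * l))%N.
  apply: (@leq_trans (2 ^ 7 * T ^ 3)).
    have -> : k = ((32 * T.+1 ^ 2).-1 * T + 1)%N by rewrite addn1.
    apply: (@leq_trans ((32 * T.+1 ^ 2).-1 * T + T)); first by rewrite leq_add2l.
    rewrite -mulSnr prednK ?muln_gt0 ?expn_gt0 //.
    have -> : (2 ^ 7 * T ^ 3 = 32 * (2 * T) ^ 2 * T)%N by ring.
    rewrite leq_mul2r leq_mul2l leq_sqr /= mul2n -addnn -addn1.
    by rewrite leq_add2l T0 orbT.
  have -> : (25 + 6 * l = 7 + (6 + 2 * l) * 3)%N by ring.
  by rewrite expnD leq_mul2l /= expnM leq_exp2r.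
have ml : (m <= 2 ^ (10 + 2 * l))%N.
  by rewrite (leq_trans md) // expnD leq_mul2l /= mulnC expnM leq_exp2r.
split.
  have mk : ((m * k) ^ d <= 2 ^ ((35 + 8 * l) * d))%N.
    rewrite expnM leq_exp2r // (leq_trans (leq_mul ml kl)) // -expnD.
    by rewrite leq_exp2l //; apply: eq_leq; ring.
  apply: (@leq_ltn_trans (2 ^ (2 + (35 + 8 * l) * d))).
    by rewrite expnD leq_mul2l.
  by rewrite ltn_exp2l // /T; nia.
apply: (@leq_trans (2 ^ 7 * T)).
  by rewrite -[(2 ^ 7)%N]/(72 + 56)%N mulnDl -addn1 leq_add2l muln_gt0 T0.
apply: (@leq_trans (2 ^ (7 + (6 + 2 * l)))); first by rewrite expnD leq_mul2l Tl orbT.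
by rewrite leq_exp2l //; lia.
Qed.

Lemma polynomial_growth_height (gT : finGroupType) (G : {group gT}) (A : {set gT})
    (d l : nat) :
    hereditarily_monomial G -> A \subset G -> symmetric_nbhd A -> normal_set G A ->
    (0 < d)%N -> (0 < l)%N -> (d <= 2 ^ l)%N ->
    (forall n, (0 < n)%N -> (#|prodset A n| <= n ^ d * #|A|)%N) ->
  exists (h : gT -> nat) (N : nat),
  [/\ (0 < N)%N, h 1%g = 0%N, {in G, forall x, h x^-1%g = h x},
      {in G &, forall x y, h (x * y)%g <= h x + h y}%N &
      {in G &, forall x y, h (x ^ y)%g = h x}] /\
  [/\ {in A, forall x, h x <= N}%N,
      (#|[set x in G | h x <= N]| <= 2 ^ (128 * d * l) * #|A|)%N &
      forall p p2 : nat, (p2 <= 2 * N)%N -> (p2 <= (2 * p).+1)%N ->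
        (#|[set x in G | h x <= p2]|
           <= 2 ^ (1920 * d * l ^ 2) * #|[set x in G | h x <= p]|)%N].
Proof.
move=> hmG AG [A1 AV] /normal_set_norm nA d0 l0 dl poly.
pose H := <<A>>%G.
have HG : H \subset G by rewrite gen_subG.
have nAH : H \subset 'N(A)%g := subset_trans HG nA.
have nHG : G \subset 'N(H)%g := subset_trans nA (norm_gen A).
have A0 : (0 < #|A|)%N by apply/card_gt0P; exists 1%g.
have f1 : (0 < #|prodset A 1|)%N by rewrite prodset1.
have poly1 n : (0 < n)%N -> (#|prodset A n| <= n ^ d * #|prodset A 1|)%N.
  by rewrite prodset1; apply: poly.
have [m [m0 md slow]] := slow_step d0 f1 poly1.
pose T := (64 * d * l)%N; pose k := ((32 * T.+1 ^ 2).-1 * T).+1.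
have [mkT T72] := scale_bounds d0 l0 dl md; rewrite -/T -/k in mkT T72.
have Sk : (#|prodset (prodset A m) k| <= (m * k) ^ d * #|A|)%N.
  by rewrite prodset_mul poly // muln_gt0 m0.
have AS : (#|A| <= #|prodset A m|)%N.
  by rewrite -{1}[A]prodset1 subset_leq_card ?prodset_sub.
have growth : (4 * #|prodset (prodset A m) k| < 2 ^ T * #|prodset A m|)%N.
  apply: (@leq_ltn_trans (4 * ((m * k) ^ d * #|A|))); first by rewrite leq_mul2l Sk.
  rewrite mulnA; apply: (@leq_trans (2 ^ T * #|A|)); first by rewrite ltn_pmul2r.
  by rewrite leq_mul2l AS orbT.
have T0 : (0 < T)%N by rewrite !muln_gt0 d0 l0.
have monH : monomial H by apply: hmG.
have [L [cF [cFinj _ cFlin cFonto] [_ cFM _ _ _]]] := lin_char_group H.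
have [h [N [[N0 h1 hV hM hJ] [hd hA hB hdbl]]]] :=
  dual_ball (erefl : <<A>>%g = H) nAH A1 AV slow monH T0 growth cFinj cFlin cFonto cFM.
(* Outside [H] the value is the upper bound for [h] on [H], which preserves subadditivity, and it
   exceeds [2 N], so the relevant balls stay inside [H]. *)
pose h' x := if x \in H then h x else (32 * N)%N.
have h'set p : (p <= 2 * N)%N -> [set x in G | h' x <= p]%N = [set x in H | h x <= p]%N.
  move=> pN; apply/setP => x; rewrite !inE /h'.
  have [xH|xH] := boolP (x \in H); first by rewrite (subsetP HG).
  by rewrite andbC leqNgt (leq_ltn_trans pN) // ltn_pmul2r.
exists h', N; split; split=> //.
- by rewrite /h' group1.
- by move=> x _; rewrite /h' groupV; case: ifP => // xH; apply: hV.
- move=> x y _ _; rewrite /h'.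
  have [xH|xH] := boolP (x \in H).
    by rewrite groupMl //; case: ifP => yH; rewrite ?hM ?leq_addl.
  case: (boolP (y \in H)) => yH; first by rewrite groupMr // (negPf xH) leq_addr.
  by case: ifP => [xyH|_]; rewrite ?leq_addl // (leq_trans (hd _ xyH)) ?leq_addl.
- move=> x y xG yG; rewrite /h' memJ_norm ?(subsetP nHG) //.
  by case: ifP => // xH; rewrite hJ // (subsetP nA).
- by move=> a aA; rewrite /h' mem_gen // hA.
- rewrite h'set ?leq_pmull // (leq_trans hB) // (leq_trans (leq_mul (leqnn 8) Sk)) //.
  rewrite mulnA leq_mul2r; apply/orP; right.
  rewrite -[8%N]/(2 * 4)%N -mulnA (leq_trans (leq_mul (leqnn 2) (ltnW mkT))) //.
  rewrite -expnS leq_exp2l // (_ : 128 * d * l = T + T)%N; last by rewrite /T; ring.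
  by rewrite -addn1 leq_add2l.
- move=> p p2 p2N p2p; rewrite h'set // (leq_trans (hdbl p p2 p2N p2p)) //.
  apply: leq_mul; last first.
    apply: subset_leq_card; apply/subsetP => x; rewrite !inE /h' => /andP[xH hx].
    by rewrite (subsetP HG _ xH) xH.
  apply: (@leq_trans ((2 ^ (15 * l)) ^ (2 * T))); first by rewrite leq_exp2r // muln_gt0 T0.
  by rewrite -expnM leq_exp2l // /T; apply: eq_leq; ring.
Qed.

(** * Passage to real parameters and real radii *)

Lemma Rpower_nat (x : R) (n : nat) : 0 < x -> Rpower x n%:R = x ^+ n.
Proof. by move=> /RltP x0; rewrite -INRE Rpower_pow ?RpowE. Qed.

Lemma Rpower_le (b x y : R) : 1 <= b -> x <= y -> Rpower b x <= Rpower b y.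
Proof. by move=> /RleP b1 /RleP xy; apply/RleP; apply: Rle_Rpower. Qed.

Lemma ln_le_mono (x y : R) : 0 < x -> x <= y -> ln x <= ln y.
Proof.
move=> /RltP x0; rewrite le_eqVlt => /orP[/eqP-> //|/RltP xy].
by apply/ltW/RltP; apply: ln_increasing.
Qed.

Lemma exp_le (x y : R) : x <= y -> exp x <= exp y.
Proof.
rewrite le_eqVlt => /orP[/eqP-> //|/RltP xy].
by apply/ltW/RltP; apply: exp_increasing.
Qed.

Lemma IZR2 : IZR 2 = 2%R.
Proof. by rewrite IZRposE INRE. Qed.

Lemma half_lt_ln2 : 2^-1 < ln 2%R.
Proof.
by apply/RltP; have := ln_lt_2; rewrite IZR2.
Qed.

Lemma ln2_lt1 : ln 2%R < 1.
Proof.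
have /RltP p2 : (0 : R) < 2 by [].
have e2 : Rlt 2%R (exp (IZR 1)) := exp_ineq1 (IZR 1) R1_neq_R0.
by apply/RltP; have := ln_increasing _ _ p2 e2; rewrite ln_exp.
Qed.

(** As [ln 2 > 1/2], both the truncated binary logarithm of [d0] and 1 are at most [2 ln (2d)],
    whence the 4. *)
Lemma nat_parameters (d : R) : 1 <= d ->
  exists d0 l : nat, [/\ (0 < d0)%N, (0 < l)%N, (d0 <= 2 ^ l)%N &
    [/\ d <= d0%:R, d0%:R <= 2 * d & l%:R <= 4%:R * ln (2 * d)%R]].
Proof.
move=> d1; have d_ge0 : 0 <= d by apply: le_trans d1.
have /andP[td dt] := truncn_itv d_ge0.
pose d0 := (Num.truncn d).+1; pose l := (trunc_log 2 d0).+1.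
have d02 : d0%:R <= 2 * d.
  by rewrite /d0 -natr1 mulrDl mul1r lerD.
exists d0, l; split=> //; first by rewrite ltnW // trunc_log_ltn.
split=> //; first exact: ltW.
have : (2 ^ trunc_log 2 d0 <= d0)%N by apply: trunc_logP.
rewrite -(ler_nat R) natrX => /le_trans/(_ d02) h.
have l1 : (trunc_log 2 d0)%:R * ln 2%R <= ln (2 * d)%R.
  have <- : ln (2 ^+ trunc_log 2 d0)%R = (trunc_log 2 d0)%:R * ln 2%R.
    by rewrite -Rpower_nat ?ltr0n // ln_Rpower.
  by apply: ln_le_mono h; rewrite exprn_gt0 ?ltr0n.
have l2 : ln 2%R <= ln (2 * d)%R by apply: ln_le_mono; rewrite ?ltr0n // ler_peMr ?ler0n.
rewrite /l -natr1; move: half_lt_ln2 l1 l2 (ler0n R (trunc_log 2 d0)).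
move: (trunc_log 2 d0)%:R (ln 2%R) (ln (2 * d)%R) => n a b; clear; nra.
Qed.

Theorem theorem1p3 :
  exists C1 C2 : R, 0 < C1 /\ 0 < C2 /\
  forall (gT : finGroupType) (G : {group gT}) (d : R) (A : {set gT}),
    hereditarily_monomial G ->
    1 <= d ->
    A \subset G ->
    symmetric_nbhd A ->
    normal_set G A ->
    (forall n : nat, (1 <= n)%N ->
       #|prodset A n|%:R <= Rpower n%:R d * #|A|%:R) ->
    exists (rho : gT -> gT -> R) (delta : R),
      pseudo_metric G rho /\ translation_invariant G rho /\ 0 < delta /\
      dim_ball G rho delta (C1 * d * (ln (2 * d)) ^+ 3) /\
      A \subset ball G rho delta /\
      #|ball G rho delta|%:R <= exp (C2 * d * ln (2 * d)) * #|A|%:R.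
Proof.
(* With [L = ln (2d) >= 1/2], [d0 <= 2d] and [l <= 4 L]: [1920 d0 l^2 <= 1920 * 32 d L^2 <= 1920 *
   64 d L^3], and [128 d0 l <= 1024 d L]. *)
exists (1920%:R * 64%:R), 1024%:R; split; first by rewrite mulr_gt0 ?ltr0n.
split; first by rewrite ltr0n.
move=> gT G d A hmG d1 AG symA nA growth; rewrite /dim_ball IZR2 !RmultE.
have [d0 [l [d0p lp d0l [dd0 d02 l4]]]] := nat_parameters d1.
have d_gt0 : 0 < d by apply: lt_le_trans d1.
have lam : 2^-1 <= ln (2 * d)%R.
  rewrite (le_trans (ltW half_lt_ln2)) //.
  by apply: ln_le_mono; rewrite ?ltr0n // ler_peMr ?ler0n.
have poly n : (0 < n)%N -> (#|prodset A n| <= n ^ d0 * #|A|)%N.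
  move=> n0; rewrite -(ler_nat R) natrM natrX (le_trans (growth n n0)) //.
  by rewrite ler_wpM2r ?ler0n // -Rpower_nat ?ltr0n // Rpower_le // ler1n.
have [h [N [[N0 h1 hV hM hJ] [hA hB hdbl]]]] :=
  polynomial_growth_height hmG AG symA nA d0p lp d0l poly.
(* Heights are integers, so a ball depends only on the floor of its radius. *)
have ballE r : 0 <= r -> ball G (fun x y => (h (x * y^-1)%g)%:R) r
    = [set x in G | h x <= Num.truncn r]%N.
  by move=> r0; apply/setP => x; rewrite !inE invg1 mulg1 truncn_ge_nat.
exists (fun x y => (h (x * y^-1)%g)%:R), N%:R; split; [|split; [|split; [|split; [|split]]]].
- move=> x y z xG yG zG; split; rewrite ?ler0n ?mulgV ?h1 //.
    by rewrite -hV ?groupM ?groupV // invMg invgK.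
  rewrite -natrD ler_nat (_ : x * z^-1 = (x * y^-1) * (y * z^-1))%g.
    by rewrite hM ?groupM ?groupV.
  by rewrite mulgA mulgKV.
(* Left translation by [z] conjugates [x y^-1], so left invariance is conjugation invariance of [h];
   right translation cancels. *)
- move=> x y z xG yG zG; split; congr _%:R.
    rewrite -[in RHS](hJ (x * y^-1)%g z^-1%g) ?groupM ?groupV //; congr h.
    by rewrite conjgE invgK invMg !mulgA.
  by rewrite invMg mulgA mulgK.
- by rewrite ltr0n.
- split=> [|r r0 rN]; first by rewrite ltr0n.
  have r_ge0 := ltW r0; have r2 : 0 <= 2 * r by rewrite mulr_ge0.
  rewrite !ballE //; set p := Num.truncn r; set p2 := Num.truncn (2 * r).
  have /andP[_ rp] := truncn_itv r_ge0; have /andP[p2r _] := truncn_itv r2.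
  have p2N : (p2 <= 2 * N)%N.
    by rewrite -(ler_nat R) natrM (le_trans p2r) // ler_pM2l.
  (* From [r < p + 1] follows [2 r < 2 p + 2], so the floor of [2 r] may exceed [2 p] by one. *)
  have p2p : (p2 <= (2 * p).+1)%N.
    rewrite -ltnS -(ltr_nat R) (le_lt_trans p2r) //.
    have -> : ((2 * p).+2 = 2 * p.+1)%N by rewrite mulnS.
    by rewrite natrM ltr_pM2l.
  have := hdbl p p2 p2N p2p; rewrite -(ler_nat R) natrM => /le_trans; apply.
  rewrite ler_wpM2r ?ler0n // natrX -[2 ^+ _]Rpower_nat ?ltr0n //.
  apply: Rpower_le; rewrite ?ler1n //.
  rewrite 2!natrM natrX -[leLHS]mulrA.
  set L := ln _; have -> : 1920%:R * 64%:R * d * L ^+ 3 = 1920%:R * (64%:R * d * L ^+ 3).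
    by rewrite -!(mulrA 1920%:R).
  rewrite ler_wpM2l ?ler0n // {}/L.
  have l_sqr : l%:R ^+ 2 <= (4%:R * ln (2 * d)%R) ^+ 2 :> R.
    by rewrite lerXn2r ?nnegrE ?ler0n // (le_trans _ l4).
  apply: (le_trans (ler_pM _ _ d02 l_sqr)); rewrite ?exprn_ge0 ?ler0n //.
  move: lam d_gt0; move: (ln _) => a la dp.
  have : 0 <= d * a ^+ 2 * (a - 2^-1).
    by rewrite mulr_ge0 ?subr_ge0 // mulr_ge0 ?ltW // exprn_gt0 //; lra.
  by nra.
- apply/subsetP => a aA; rewrite ballE ?ler0n // inE (subsetP AG) // natrK.
  exact: hA.
rewrite ballE ?ler0n // natrK (le_trans (_ : _ <= (2 ^ (128 * d0 * l) * #|A|)%:R)) //.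
  by rewrite ler_nat.
rewrite natrM ler_wpM2r ?ler0n // natrX -[2 ^+ _]Rpower_nat ?ltr0n //.
apply: exp_le; set L := ln (2 * d)%R in lam l4 *.
have L0 : 0 <= L by apply: le_trans lam; rewrite invr_ge0 ler0n.
have n0 : 0 <= (128 * d0 * l)%:R :> R by [].
apply: (@le_trans _ _ (128 * d0 * l)%:R); first by rewrite ler_piMr // ltW // ln2_lt1.
rewrite !natrM -[1024%N]/(128 * 8)%N natrM -!mulrA ler_wpM2l ?ler0n //.
apply: (le_trans (ler_pM _ _ d02 l4)); rewrite ?ler0n //.
by rewrite le_eqVlt; apply/orP; left; apply/eqP; ring.
Qed.
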